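(* Let $\alpha>0$ and let $f\in\mathcal{B}_1(\alpha)$, with logarithmic coefficients $\gamma_1,\gamma_2$. Then $$-\frac{1}{\sqrt{(\alpha+1)^2+1}}\le |\gamma_2|-|\gamma_1|\le \frac{1}{\alpha+2}.$$ The right-hand estimate is sharp for every $\alpha>0$, i.e. for every $\alpha>0$ there is a function $f\in\mathcal{B}_1(\alpha)$ with $|\gamma_2|-|\gamma_1|=\frac{1}{\alpha+2}$. The left-hand estimate is sharp for every $\alpha$ with $\alpha_1\le\alpha\le\alpha_2$, i.e. for every such $\alpha$ there is a function $f\in\mathcal{B}_1(\alpha)$ with $|\gamma_2|-|\gamma_1|=-\frac{1}{\sqrt{(\alpha+1)^2+1}}$. Here $\alpha_1=\frac12\left(\sqrt6-2\right)=0.2247\ldots$ and $\alpha_2=\sqrt2-1=0.4142\ldots$ are the positive roots of the equation $$2\alpha^4+8\alpha^3+5\alpha^2-6\alpha+1=0.$$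
   Context: Let $\mathbb{D}=\{z\in\mathbb{C}:|z|<1\}$ be the open unit disk and let $\mathcal{A}$ be the class of analytic functions $f$ in $\mathbb{D}$ normalized by $f(0)=0$, $f'(0)=1$, i.e. $f(z)=z+a_2z^2+a_3z^3+\cdots$. For $\alpha>0$, the class $\mathcal{B}_1(\alpha)$ (a Bazilevič-type class) consists of those $f\in\mathcal{A}$ satisfying $$\operatorname{Re}\left[\left(\frac{f(z)}{z}\right)^{\alpha-1}f'(z)\right]>0\quad\text{for all } z\in\mathbb{D}.$$ It is known that $\mathcal{B}_1(\alpha)$ is a subclass of the class $\mathcal{S}$ of univalent (injective) functions in $\mathcal{A}$. Here $f(z)/z$ is understood to take the value $1$ at $z=0$ and to be non-vanishing in $\mathbb{D}$, and the power $(f(z)/z)^{\alpha-1}$ and the logarithm $\log(f(z)/z)$ are the analytic branches in $\mathbb{D}$ taking the values $1$ and $0$, respectively, at $z=0$. The logarithmic coefficients $\gamma_n$, $n=1,2,\ldots$, of $f$ are defined by $$\log\frac{f(z)}{z}=2\sum_{n=1}^\infty\gamma_n z^n,\qquad z\in\mathbb{D}.$$ In particular $\gamma_1=\frac{a_2}{2}$ and $\gamma_2=\frac12\left(a_3-\frac12a_2^2\right)$. *)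

(* Defs.v *)
From Stdlib Require Import Reals.
From Coquelicot Require Import Coquelicot.

Open Scope R_scope.

Definition Cexp (z : C) : C :=
  (exp (Re z) * cos (Im z), exp (Re z) * sin (Im z)).

Definition in_disk (z : C) : Prop := Cmod z < 1.

(* Functions on the disk are represented by total functions on [C]; the disk
   being open, their values outside it play no role. The derivative is the
   complex one. *)
Definition analytic_on_disk (f : C -> C) : Prop :=
  forall z : C, in_disk z ->
    ex_derive (K := C_AbsRing) (V := C_NormedModule) f z.

Definition class_A (f : C -> C) : Prop :=
  analytic_on_disk f /\ f (RtoC 0) = RtoC 0 /\ C_derive f (RtoC 0) = RtoC 1.

(* f(z)/z, with its removable singularity filled in as for f in [class_A]. *)
Definition quot_id (f : C -> C) (z : C) : C :=
  if Ceq_dec z (RtoC 0) then RtoC 1 else (f z / z)%C.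

(* [L] is the analytic branch in the disk of log g with value 0 at 0. By
   connectedness of the disk it is unique there; when g is analytic and
   non-vanishing with g(0) = 1, it exists. *)
Definition is_log_branch (g L : C -> C) : Prop :=
  analytic_on_disk L /\ L (RtoC 0) = RtoC 0 /\
  forall z : C, in_disk z -> Cexp (L z) = g z.

(* The branch of (f(z)/z)^(alpha-1) with value 1 at 0 is
   exp((alpha-1) log(f(z)/z)). *)
Definition class_B1 (alpha : R) (f : C -> C) : Prop :=
  class_A f /\
  (forall z : C, in_disk z -> quot_id f z <> RtoC 0) /\
  exists L : C -> C,
    is_log_branch (quot_id f) L /\
    forall z : C, in_disk z ->
      0 < Re (Cexp (RtoC (alpha - 1) * L z) * C_derive f z)%C.

(* The expansion starts at index 1, so the value of [gamma] at 0 is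
   irrelevant. *)
Definition log_coefficients (f : C -> C) (gamma : nat -> C) : Prop :=
  exists L : C -> C,
    is_log_branch (quot_id f) L /\
    forall z : C, in_disk z ->
      is_series (K := C_AbsRing) (V := C_NormedModule)
        (fun n : nat => (RtoC 2 * (gamma (S n) * z ^ S n))%C) (L z).

Definition alpha1 : R := / 2 * (sqrt 6 - 2).
Definition alpha2 : R := sqrt 2 - 1.

(* Main.v *)
Require Import Defs.
From Stdlib Require Import Reals Lra Lia Psatz.
From Coquelicot Require Import Coquelicot.

(** Write log(f(z)/z) = L(z) and G = exp(alpha L) = (f(z)/z)^alpha. The function
    (f(z)/z)^(alpha-1) f'(z) equals P = G + z G' / alpha, so f belongs to the class
    exactly when P, normalised by P(0) = 1, has positive real part. Comparing
    coefficients expresses those of P through gamma_1 and gamma_2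
    ([B1_caratheodory_coefs]).

    The bounds. A function P = 1 + p1 z + p2 z^2 + ... with positive real part
    satisfies |p2 - p1^2/2| <= 2 - |p1|^2/2 ([caratheodory_second]). It follows from
    the positivity of the mean of Re(P) |X|^2 over circles for quadratic polynomials
    X ([coefficient_positivity]). In logarithmic coefficients it reads
    |(alpha+2) gamma_2 - gamma_1^2| <= 1 - (alpha+1)^2 |gamma_1|^2, and both estimates
    for |gamma_2| - |gamma_1| are then elementary ([modulus_difference_bounds]).

    Sharpness. Conversely every such P comes from a function of the class
    ([B1_of_caratheodory]): P = G + z G' / alpha is solved coefficient by
    coefficient, Re G > 0 follows by monotonicity along rays ([Re_pos_from_euler]), and
    log G is a power series converging in the whole disk because 1 / G is one
    ([reciprocal_PS]). The functions P(z) = (1 - z^2) / (1 - 2 c z + z^2) with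
    -1 <= c <= 1 give equality in the coefficient inequality; c = 0 makes gamma_1
    vanish and attains the upper bound, and a suitable c makes gamma_2 vanish and
    attains the lower one.

    Only power series in the disk are involved: convergence in the disk is the growth
    condition [subexp] on the coefficients, stable under the operations used, and
    means over roots of unity take the place of integrals over circles. *)

Open Scope R_scope.

(** * Differentiation of complex functions *)

Notation is_Cderive := (is_derive (K := C_AbsRing) (V := C_NormedModule)).

Lemma is_Cderive_eps (f : C -> C) (z l : C) :
  is_Cderive f z l <->
  (forall eps : posreal, exists d : R, 0 < d /\
     forall h : C, Cmod h < d ->
       Cmod (f (z + h) - f z - l * h)%C <= eps * Cmod h).
Proof.
  split.
  - intros [_ H] eps.
    destruct (H z (fun P HP => HP) eps) as [d Hd].
    exists d. split; [apply cond_pos|]. intros h Hh.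
    specialize (Hd (z + h)%C).
    assert (B : @ball (AbsRing_UniformSpace C_AbsRing) z d (z + h)%C).
    { change (Cmod (z + h + - z)%C < d).
      replace (z + h + - z)%C with h by ring. exact Hh. }
    specialize (Hd B). cbv beta in Hd.
    change (Cmod (f (z + h) - f z + - ((z + h + - z) * l))%C <= eps * Cmod (z + h + - z)%C) in Hd.
    replace (z + h + - z)%C with h in Hd by ring.
    replace (f (z + h) - f z - l * h)%C with (f (z + h) - f z + - (h * l))%C by ring.
    exact Hd.
  - intros H. split; [apply is_linear_scal_l|].
    intros x Hx eps.
    assert (Ex : x = z).
    { symmetry. exact (is_filter_lim_locally_unique (V := AbsRing_NormedModule C_AbsRing) z x Hx). }
    subst x.
    destruct (H eps) as [d [Hd Hh]].
    exists (mkposreal d Hd). intros y. change C in y. intros Hy.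
    change (Cmod (y - z)%C < d) in Hy.
    specialize (Hh (y - z)%C Hy).
    replace (z + (y - z))%C with y in Hh by ring.
    change (Cmod (f y - f z + - ((y - z) * l))%C <= eps * Cmod (y - z)%C).
    replace (f y - f z + - ((y - z) * l))%C with (f y - f z - l * (y - z))%C by ring.
    exact Hh.
Qed.

(** C carries two normed-module structures over itself; the product and chain rules
    below are available for the one coming from its absolute value. *)
Lemma is_Cderive_ring (f : C -> C) (z l : C) :
  is_Cderive f z l <->
  is_derive (K := C_AbsRing) (V := AbsRing_NormedModule C_AbsRing) f z l.
Proof. split; intros [_ H]; (split; [apply is_linear_scal_l|exact H]). Qed.

Lemma is_Cderive_mult (f g : C -> C) (z df dg : C) :
  is_Cderive f z df -> is_Cderive g z dg ->
  is_Cderive (fun w => f w * g w)%C z (df * g z + f z * dg)%C.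
Proof.
  rewrite !is_Cderive_ring. intros Hf Hg. exact (is_derive_mult (K := C_AbsRing) f g z df dg Hf Hg Cmult_comm).
Qed.

Lemma is_Cderive_comp (f g : C -> C) (z df dg : C) :
  is_Cderive f (g z) df -> is_Cderive g z dg ->
  is_Cderive (fun w => f (g w)) z (dg * df)%C.
Proof.
  rewrite (is_Cderive_ring g). exact (is_derive_comp (K := C_AbsRing) (V := C_NormedModule) f g z df dg).
Qed.

Lemma is_Cderive_plus (f g : C -> C) (z df dg : C) :
  is_Cderive f z df -> is_Cderive g z dg ->
  is_Cderive (fun w => f w + g w)%C z (df + dg)%C.
Proof. exact (is_derive_plus (K := C_AbsRing) (V := C_NormedModule) f g z df dg). Qed.

Lemma is_Cderive_const (c z : C) : is_Cderive (fun _ => c) z (RtoC 0).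
Proof. exact (is_derive_const (K := C_AbsRing) (V := C_NormedModule) c z). Qed.

Lemma is_Cderive_id (z : C) : is_Cderive (fun w => w) z (RtoC 1).
Proof. rewrite is_Cderive_ring. exact (is_derive_id (K := C_AbsRing) z). Qed.

Lemma is_Cderive_scal (f : C -> C) (c z df : C) :
  is_Cderive f z df -> is_Cderive (fun w => c * f w)%C z (c * df)%C.
Proof.
  intros Hf.
  replace (c * df)%C with (RtoC 0 * f z + c * df)%C by ring.
  exact (is_Cderive_mult (fun _ => c) f z _ _ (is_Cderive_const c z) Hf).
Qed.

Lemma is_Cderive_unique (f : C -> C) (z l1 l2 : C) :
  is_Cderive f z l1 -> is_Cderive f z l2 -> l1 = l2.
Proof.
  intros H1 H2.
  rewrite <- (is_C_derive_unique f z l1 H1). exact (is_C_derive_unique f z l2 H2).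
Qed.

Lemma in_disk_near (z : C) : in_disk z ->
  exists d, 0 < d /\ forall h, Cmod h < d -> in_disk (z + h)%C.
Proof.
  unfold in_disk. intros Hz. exists (1 - Cmod z). split; [lra|].
  intros h Hh. pose proof (Cmod_triangle z h). lra.
Qed.

Lemma is_Cderive_ext_disk (f g : C -> C) (z l : C) :
  (forall w, in_disk w -> f w = g w) -> in_disk z ->
  is_Cderive f z l -> is_Cderive g z l.
Proof.
  intros E Hz. rewrite !is_Cderive_eps. intros H eps.
  destruct (H eps) as [d1 [P1 H1]]. destruct (in_disk_near z Hz) as [d2 [P2 H2]].
  exists (Rmin d1 d2). split; [apply Rmin_pos; assumption|].
  intros h Hh. pose proof (Rmin_l d1 d2). pose proof (Rmin_r d1 d2).
  rewrite <- !E; [apply H1; lra|exact Hz|apply H2; lra].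
Qed.

Lemma Cexp_plus (z w : C) : Cexp (z + w)%C = (Cexp z * Cexp w)%C.
Proof.
  destruct z as [a b], w as [c d]. unfold Cexp, Cmult; simpl.
  rewrite exp_plus, cos_plus, sin_plus. f_equal; ring.
Qed.

Lemma Cexp_0 : Cexp (RtoC 0) = RtoC 1.
Proof. unfold Cexp, RtoC; simpl. rewrite exp_0, cos_0, sin_0. f_equal; ring. Qed.

Lemma Cexp_neq_0 (z : C) : Cexp z <> RtoC 0.
Proof.
  intros H. assert (E : (Cexp z * Cexp (- z) = RtoC 1)%C).
  { rewrite <- Cexp_plus, Cplus_opp_r. exact Cexp_0. }
  rewrite H, Cmult_0_l in E. now apply C1_nz.
Qed.

Lemma Rderive_eps (f : R -> R) (x l : R) : is_derive f x l ->
  forall eps, 0 < eps -> exists d, 0 < d /\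
    forall h, Rabs h < d -> Rabs (f (x + h) - f x - l * h) <= eps * Rabs h.
Proof.
  intros H eps He. apply is_derive_Reals in H.
  destruct (H eps He) as [d Hd]. exists d. split; [apply cond_pos|].
  intros h Hh. destruct (Req_dec h 0) as [->|Hn].
  - rewrite Rplus_0_r, Rabs_R0.
    replace (f x - f x - l * 0) with 0 by ring. rewrite Rabs_R0; lra.
  - specialize (Hd h Hn Hh).
    replace (f (x + h) - f x - l * h) with (((f (x + h) - f x) / h - l) * h) by (field; exact Hn).
    rewrite Rabs_mult. apply Rmult_le_compat_r; [apply Rabs_pos|lra].
Qed.

Lemma Cmod_le_Rabs (z : C) : Cmod z <= Rabs (Re z) + Rabs (Im z).
Proof.
  destruct z as [a b]. simpl.
  replace (a, b) with (RtoC a + Ci * RtoC b)%C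
    by (unfold RtoC, Ci, Cplus, Cmult; simpl; f_equal; ring).
  eapply Rle_trans; [apply Cmod_triangle|].
  rewrite Cmod_mult, !Cmod_R, Cmod_Ci. lra.
Qed.

Lemma Rabs_Re_le (z : C) : Rabs (Re z) <= Cmod z.
Proof. eapply Rle_trans; [|apply Rmax_Cmod]. apply Rmax_l. Qed.

Lemma Rabs_Im_le (z : C) : Rabs (Im z) <= Cmod z.
Proof. eapply Rle_trans; [|apply Rmax_Cmod]. apply Rmax_r. Qed.

Lemma is_Cderive_Cexp (z : C) : is_Cderive Cexp z (Cexp z).
Proof.
  assert (H0 : is_Cderive Cexp (RtoC 0) (RtoC 1)).
  { apply is_Cderive_eps. intros [e He]. simpl.
    pose (e1 := Rmin (e / 8) 1).
    assert (P1 : 0 < e1) by (apply Rmin_pos; lra).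
    assert (Q1 : e1 <= e / 8) by apply Rmin_l.
    assert (R1 : e1 <= 1) by apply Rmin_r.
    clearbody e1.
    destruct (Rderive_eps exp 0 1) with (eps := e1) as [d1 [D1 K1]]; [|exact P1|].
    { apply is_derive_Reals. rewrite <- exp_0. apply derivable_pt_lim_exp. }
    destruct (Rderive_eps cos 0 0) with (eps := e1) as [d2 [D2 K2]]; [|exact P1|].
    { apply is_derive_Reals. pose proof (derivable_pt_lim_cos 0) as Dc.
      rewrite sin_0, Ropp_0 in Dc. exact Dc. }
    destruct (Rderive_eps sin 0 1) with (eps := e1) as [d3 [D3 K3]]; [|exact P1|].
    { apply is_derive_Reals. rewrite <- cos_0. apply derivable_pt_lim_sin. }
    pose (d := Rmin (Rmin d1 d2) (Rmin d3 e1)).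
    assert (Dd : 0 < d) by (repeat apply Rmin_pos; assumption).
    assert (Ed : d <= d1 /\ d <= d2 /\ d <= d3 /\ d <= e1).
    { unfold d. pose proof (Rmin_l (Rmin d1 d2) (Rmin d3 e1)).
      pose proof (Rmin_r (Rmin d1 d2) (Rmin d3 e1)).
      pose proof (Rmin_l d1 d2). pose proof (Rmin_r d1 d2).
      pose proof (Rmin_l d3 e1). pose proof (Rmin_r d3 e1). lra. }
    exists d. split; [exact Dd|]. intros [x y] Hh.
    pose proof (Rabs_Re_le (x, y)) as Bx. pose proof (Rabs_Im_le (x, y)) as By.
    simpl in Bx, By. set (m := Cmod (x, y)) in *.
    specialize (K1 x ltac:(lra)). specialize (K2 y ltac:(lra)). specialize (K3 y ltac:(lra)).
    rewrite Rplus_0_l, exp_0 in K1. rewrite Rplus_0_l, cos_0 in K2.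
    rewrite Rplus_0_l, sin_0 in K3.
    rewrite Cplus_0_l, Cexp_0.
    eapply Rle_trans; [apply Cmod_le_Rabs|].
    unfold Cexp, RtoC; simpl.
    pose proof (Rabs_pos x) as Px. pose proof (Rabs_pos y) as Py.
    assert (Cc : Rabs (cos y) <= 1) by (apply Rabs_le; apply COS_bound).
    assert (Cs : Rabs (sin y) <= 2 * Rabs y).
    { replace (sin y) with ((sin y - 0 - 1 * y) + y) by ring.
      eapply Rle_trans; [apply Rabs_triang|]. nra. }
    assert (Ce : Rabs (exp x - 1) <= 2 * Rabs x).
    { replace (exp x - 1) with ((exp x - 1 - 1 * x) + x) by ring.
      eapply Rle_trans; [apply Rabs_triang|]. nra. }
    assert (A1 : Rabs (exp x * cos y + - (1) + - (1 * x - 0 * y)) <= 3 * e1 * m).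
    { replace (exp x * cos y + - (1) + - (1 * x - 0 * y))
        with ((exp x - 1 - 1 * x) * cos y + (1 + x) * (cos y - 1 - 0 * y)) by ring.
      eapply Rle_trans; [apply Rabs_triang|]. rewrite !Rabs_mult.
      assert (Rabs (1 + x) <= 2).
      { eapply Rle_trans; [apply Rabs_triang|]. rewrite Rabs_R1. lra. }
      pose proof (Rabs_pos (exp x - 1 - 1 * x)). pose proof (Rabs_pos (cos y - 1 - 0 * y)).
      pose proof (Rabs_pos (cos y)). pose proof (Rabs_pos (1 + x)).
      assert (Rabs (exp x - 1 - 1 * x) * Rabs (cos y) <= e1 * m * 1).
      { apply Rmult_le_compat; try lra. nra. }
      assert (Rabs (1 + x) * Rabs (cos y - 1 - 0 * y) <= 2 * (e1 * m)).
      { apply Rmult_le_compat; try lra. nra. }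
      lra. }
    assert (A2 : Rabs (exp x * sin y + - 0 + - (1 * y + 0 * x)) <= 5 * e1 * m).
    { replace (exp x * sin y + - 0 + - (1 * y + 0 * x))
        with ((exp x - 1) * sin y + (sin y - 0 - 1 * y)) by ring.
      eapply Rle_trans; [apply Rabs_triang|]. rewrite !Rabs_mult.
      pose proof (Rabs_pos (exp x - 1)). pose proof (Rabs_pos (sin y)).
      assert (Rabs (exp x - 1) * Rabs (sin y) <= (2 * e1) * (2 * m)).
      { apply Rmult_le_compat; lra. }
      nra. }
    assert (0 <= m) by apply Cmod_ge_0. nra. }
  (* Elsewhere, by the addition formula. *)
  apply is_Cderive_eps. intros eps.
  assert (Pz : 0 < Cmod (Cexp z)) by (apply Cmod_gt_0, Cexp_neq_0).
  assert (Pe : 0 < eps / Cmod (Cexp z)) by (apply Rdiv_lt_0_compat; [apply cond_pos|exact Pz]).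
  destruct (proj1 (is_Cderive_eps _ _ _) H0 (mkposreal _ Pe)) as [d [Hd K]].
  exists d. split; [exact Hd|]. intros h Hh. specialize (K h Hh). simpl in K.
  rewrite Cplus_0_l, Cexp_0 in K.
  replace (Cexp (z + h) - Cexp z - Cexp z * h)%C
    with (Cexp z * (Cexp h - RtoC 1 - RtoC 1 * h))%C by (rewrite Cexp_plus; ring).
  rewrite Cmod_mult.
  apply Rmult_le_compat_l with (r := Cmod (Cexp z)) in K; [|lra].
  replace (Cmod (Cexp z) * (eps / Cmod (Cexp z) * Cmod h)) with (eps * Cmod h) in K by (field; lra).
  exact K.
Qed.

(** Restricting a holomorphic function to a ray reduces global statements on the
    disk to one real variable and the mean value theorem. *)
Lemma is_derive_ray (f : C -> C) (w l : C) (t : R) :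
  is_Cderive f (RtoC t * w)%C l ->
  is_derive (fun s : R => Re (f (RtoC s * w)%C)) t (Re (l * w)%C) /\
  is_derive (fun s : R => Im (f (RtoC s * w)%C)) t (Im (l * w)%C).
Proof.
  intros H.
  assert (K : forall e, 0 < e -> exists d, 0 < d /\ forall h : R, Rabs h < d ->
     Cmod (f (RtoC (t + h) * w) - f (RtoC t * w) - RtoC h * (l * w))%C <= e * Rabs h).
  { intros e He. pose proof (Cmod_ge_0 w) as Pw.
    assert (Pe : 0 < e / (Cmod w + 1)) by (apply Rdiv_lt_0_compat; lra).
    destruct (proj1 (is_Cderive_eps _ _ _) H (mkposreal _ Pe)) as [d [Hd K]].
    exists (d / (Cmod w + 1)). split; [apply Rdiv_lt_0_compat; lra|].
    intros h Hh. pose proof (Rabs_pos h).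
    assert (B : Rabs h * (Cmod w + 1) < d).
    { apply Rmult_lt_compat_r with (r := Cmod w + 1) in Hh; [|lra].
      replace (d / (Cmod w + 1) * (Cmod w + 1)) with d in Hh by (field; lra). exact Hh. }
    assert (M : Cmod (RtoC h * w)%C = Rabs h * Cmod w) by now rewrite Cmod_mult, Cmod_R.
    specialize (K (RtoC h * w)%C ltac:(rewrite M; nra)).
    rewrite M in K. simpl in K.
    replace (RtoC (t + h) * w)%C with (RtoC t * w + RtoC h * w)%C by (rewrite RtoC_plus; ring).
    replace (RtoC h * (l * w))%C with (l * (RtoC h * w))%C by ring.
    eapply Rle_trans; [exact K|].
    replace (e / (Cmod w + 1) * (Rabs h * Cmod w)) with (e * Rabs h * (Cmod w / (Cmod w + 1))) by (field; lra).
    assert (Cmod w / (Cmod w + 1) <= 1).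
    { apply Rmult_le_reg_r with (Cmod w + 1); [lra|].
      unfold Rdiv. rewrite Rmult_assoc, Rinv_l; lra. }
    assert (0 <= e * Rabs h) by nra. nra. }
  assert (G : forall part : C -> R,
     (forall z, Rabs (part z) <= Cmod z) ->
     (forall a b c h, part (a - b - RtoC h * c)%C = part a - part b - h * part c) ->
     is_derive (fun s : R => part (f (RtoC s * w)%C)) t (part (l * w)%C)).
  { intros part Hp Hl. apply is_derive_Reals. intros e He.
    destruct (K (e / 2) ltac:(lra)) as [d [Hd Kd]].
    exists (mkposreal d Hd). intros h Hn Hh. simpl in Hh.
    specialize (Kd h Hh).
    pose proof (Hp (f (RtoC (t + h) * w) - f (RtoC t * w) - RtoC h * (l * w))%C) as B.
    rewrite Hl in B.
    replace ((part (f (RtoC (t + h) * w)%C) - part (f (RtoC t * w)%C)) / h - part (l * w)%C)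
      with ((part (f (RtoC (t + h) * w)%C) - part (f (RtoC t * w)%C) - h * part (l * w)%C) / h)
      by (field; exact Hn).
    unfold Rdiv. rewrite Rabs_mult, Rabs_inv.
    assert (Ph : 0 < Rabs h) by now apply Rabs_pos_lt.
    apply Rmult_lt_reg_r with (Rabs h); [exact Ph|].
    rewrite Rmult_assoc, Rinv_l, Rmult_1_r; [|lra]. nra. }
  split.
  - apply (G Re Rabs_Re_le). intros [a1 a2] [b1 b2] [c1 c2] h. simpl. ring.
  - apply (G Im Rabs_Im_le). intros [a1 a2] [b1 b2] [c1 c2] h. simpl. ring.
Qed.

Lemma Cderive_0_const (f : C -> C) :
  (forall z, in_disk z -> is_Cderive f z (RtoC 0)) ->
  forall z, in_disk z -> f z = f (RtoC 0).
Proof.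
  intros H z Hz.
  assert (D : forall t, 0 <= t <= 1 -> in_disk (RtoC t * z)%C).
  { intros t Ht. unfold in_disk in *. rewrite Cmod_mult, Cmod_R, Rabs_pos_eq by lra.
    pose proof (Cmod_ge_0 z). nra. }
  assert (G : forall u : R -> R, (forall t, 0 <= t <= 1 -> is_derive u t 0) -> u 1 = u 0).
  { intros u Hu.
    destruct (MVT_gen u 0 1 (fun _ => 0)) as [c [_ E]].
    - rewrite Rmin_left, Rmax_right by lra. intros x Hx. apply Hu; lra.
    - rewrite Rmin_left, Rmax_right by lra. intros x Hx.
      apply derivable_continuous_pt. exists 0. apply is_derive_Reals, Hu, Hx.
    - lra. }
  assert (E1 : (RtoC 1 * z = z)%C) by ring. assert (E0 : (RtoC 0 * z = RtoC 0)%C) by ring.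
  assert (ER : Re (f z) = Re (f (RtoC 0))).
  { pose proof (G (fun t => Re (f (RtoC t * z)%C))) as K. cbv beta in K. rewrite E1, E0 in K.
    apply K. intros t Ht. pose proof (proj1 (is_derive_ray f z _ t (H _ (D t Ht)))) as K1.
    rewrite Cmult_0_l in K1. exact K1. }
  assert (EI : Im (f z) = Im (f (RtoC 0))).
  { pose proof (G (fun t => Im (f (RtoC t * z)%C))) as K. cbv beta in K. rewrite E1, E0 in K.
    apply K. intros t Ht. pose proof (proj2 (is_derive_ray f z _ t (H _ (D t Ht)))) as K1.
    rewrite Cmult_0_l in K1. exact K1. }
  rewrite (surjective_pairing (f z)), (surjective_pairing (f (RtoC 0))).
  f_equal; assumption.
Qed.

(** The quotient g / Cexp L has derivative 0. This is how a function given by a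
    power series is recognised as an exponential. *)
Lemma ODE_exp (g L l : C -> C) :
  (forall z, in_disk z -> is_Cderive L z (l z)) ->
  (forall z, in_disk z -> is_Cderive g z (l z * g z)%C) ->
  L (RtoC 0) = RtoC 0 -> g (RtoC 0) = RtoC 1 ->
  forall z, in_disk z -> Cexp (L z) = g z.
Proof.
  intros HL Hg L0 g0 z Hz.
  assert (E : (g z * Cexp (RtoC (-1) * L z) = g (RtoC 0) * Cexp (RtoC (-1) * L (RtoC 0)))%C).
  { apply (Cderive_0_const (fun w => g w * Cexp (RtoC (-1) * L w))%C); [|exact Hz].
    intros w Hw.
    pose proof (is_Cderive_mult g _ w _ _ (Hg w Hw)
      (is_Cderive_comp Cexp (fun v => RtoC (-1) * L v)%C w _ _ (is_Cderive_Cexp _)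
        (is_Cderive_scal L (RtoC (-1)) w _ (HL w Hw)))) as K.
    replace (RtoC 0) with (l w * g w * Cexp (RtoC (-1) * L w) +
      g w * (RtoC (-1) * l w * Cexp (RtoC (-1) * L w)))%C by ring. exact K. }
  rewrite L0, g0, Cmult_0_r, Cexp_0 in E.
  assert (I : (Cexp (L z) * Cexp (RtoC (-1) * L z) = RtoC 1)%C).
  { rewrite <- Cexp_plus, <- Cexp_0. f_equal. ring. }
  replace (Cexp (L z)) with (Cexp (L z) * (g z * Cexp (RtoC (-1) * L z)))%C by (rewrite E; ring).
  replace (Cexp (L z) * (g z * Cexp (RtoC (-1) * L z)))%C
    with (g z * (Cexp (L z) * Cexp (RtoC (-1) * L z)))%C by ring.
  rewrite I. ring.
Qed.

(** Makes the logarithm in the definition of the class and the one expanded into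
    logarithmic coefficients the same function. *)
Lemma log_branch_unique (g L1 L2 : C -> C) :
  is_log_branch g L1 -> is_log_branch g L2 -> forall z, in_disk z -> L1 z = L2 z.
Proof.
  intros [A1 [Z1 E1]] [A2 [Z2 E2]] z Hz.
  assert (K : (L1 z + RtoC (-1) * L2 z = L1 (RtoC 0) + RtoC (-1) * L2 (RtoC 0))%C).
  { apply (Cderive_0_const (fun w => L1 w + RtoC (-1) * L2 w)%C); [|exact Hz].
    intros w Hw.
    (* Both chain rules compute the derivative of g, and Cexp does not vanish. *)
    destruct (A1 w Hw) as [l1 D1]. destruct (A2 w Hw) as [l2 D2].
    change C in l1, l2.
    pose proof (is_Cderive_comp Cexp L1 w _ _ (is_Cderive_Cexp _) D1) as K1.
    pose proof (is_Cderive_comp Cexp L2 w _ _ (is_Cderive_Cexp _) D2) as K2.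
    apply (is_Cderive_ext_disk _ (fun v => Cexp (L1 v))) in K2;
      [|intros v Hv; rewrite E1, E2 by exact Hv; reflexivity|exact Hw].
    pose proof (is_Cderive_unique _ _ _ _ K1 K2) as E.
    rewrite E1, E2 in E by exact Hw. rewrite <- (E1 w Hw) in E.
    assert (El : l1 = l2).
    { pose proof (Cexp_neq_0 (L1 w)) as Nz.
      replace l1 with (l1 * Cexp (L1 w) / Cexp (L1 w))%C by (field; exact Nz).
      rewrite E. field. exact Nz. }
    pose proof (is_Cderive_plus _ _ w _ _ D1 (is_Cderive_scal L2 (RtoC (-1)) w _ D2)) as K.
    replace (RtoC 0) with (l1 + RtoC (-1) * l2)%C by (rewrite El; ring). exact K. }
  rewrite Z1, Z2 in K.
  replace (L1 z) with (L1 z + RtoC (-1) * L2 z + L2 z)%C by ring. rewrite K. ring.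
Qed.

(** * Finite sums and series of complex numbers *)

Lemma RtoC_neq_0 (x : R) : x <> 0 -> RtoC x <> RtoC 0.
Proof. intros H E. now apply RtoC_inj in E. Qed.

Notation Csum := (sum_n (G := C_AbelianMonoid)).

Notation is_Cseries := (is_series (K := C_AbsRing) (V := C_NormedModule)).

Lemma Csum_0 (u : nat -> C) : Csum u 0 = u 0%nat.
Proof. exact (sum_O u). Qed.

Lemma Csum_S (u : nat -> C) (n : nat) : Csum u (S n) = (Csum u n + u (S n))%C.
Proof. exact (sum_Sn u n). Qed.

Lemma Csum_ext (u v : nat -> C) (n : nat) :
  (forall k, (k <= n)%nat -> u k = v k) -> Csum u n = Csum v n :> C.
Proof. exact (sum_n_ext_loc u v n). Qed.

Lemma Csum_mult_l (c : C) (u : nat -> C) (n : nat) :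
  Csum (fun k => c * u k)%C n = (c * Csum u n)%C :> C.
Proof. exact (sum_n_mult_l (K := C_Ring) c u n). Qed.

Lemma Csum_switch (u : nat -> nat -> C) (m n : nat) :
  Csum (fun i => Csum (u i) n) m = Csum (fun j => Csum (fun i => u i j) m) n :> C.
Proof. exact (sum_n_switch u m n). Qed.

Lemma Csum_const (c : C) (n : nat) : Csum (fun _ => c) n = (RtoC (INR (S n)) * c)%C :> C.
Proof.
  induction n as [|n IH]; [rewrite Csum_0; simpl; ring|].
  rewrite Csum_S, IH, (S_INR (S n)), RtoC_plus. ring.
Qed.

Lemma Csum_single (u : nat -> C) (k n : nat) : (k <= n)%nat ->
  (forall j, (j <= n)%nat -> j <> k -> u j = RtoC 0) -> Csum u n = u k :> C.
Proof.
  intros Hk Hu. induction n as [|n IH].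
  - rewrite Csum_0. now replace k with 0%nat by lia.
  - rewrite Csum_S. destruct (Nat.eq_dec k (S n)) as [->|Hn].
    + rewrite (Csum_ext u (fun _ => RtoC 0)); [rewrite Csum_const; ring|].
      intros j Hj. apply Hu; lia.
    + rewrite IH by (try lia; intros j Hj; apply Hu; lia). rewrite (Hu (S n)) by lia. ring.
Qed.

Lemma Csum_first (u : nat -> C) (n : nat) :
  Csum u (S n) = (u 0%nat + Csum (fun k => u (S k)) n)%C :> C.
Proof.
  induction n as [|n IH]; [now rewrite Csum_S, !Csum_0|].
  rewrite Csum_S, IH, Csum_S. ring.
Qed.

Lemma Cconj_Csum (u : nat -> C) (n : nat) :
  Cconj (Csum u n) = Csum (fun k => Cconj (u k)) n :> C.
Proof.
  induction n as [|n IH]; [now rewrite !Csum_0|].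
  rewrite !Csum_S, <- IH. apply Cplus_conj.
Qed.

Lemma Re_Csum (u : nat -> C) (n : nat) : Re (Csum u n) = sum_n (fun k => Re (u k)) n.
Proof.
  induction n as [|n IH]; [now rewrite Csum_0, sum_O|].
  rewrite Csum_S, sum_Sn, <- IH. reflexivity.
Qed.

Lemma Im_Csum (u : nat -> C) (n : nat) : Im (Csum u n) = sum_n (fun k => Im (u k)) n.
Proof.
  induction n as [|n IH]; [now rewrite Csum_0, sum_O|].
  rewrite Csum_S, sum_Sn, <- IH. reflexivity.
Qed.

Lemma is_Cseries_iff (u : nat -> C) (s : C) :
  is_Cseries u s <->
  is_series (fun n => Re (u n)) (Re s) /\ is_series (fun n => Im (u n)) (Im s).
Proof.
  unfold is_series. split.
  - intros H. pose proof (proj1 (filterlim_locally (U := C_UniformSpace) (Csum u) s) H) as K.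
    split; apply filterlim_locally; intros eps; generalize (K eps); apply filter_imp; intros n Hn.
    + rewrite <- Re_Csum. exact (proj1 Hn).
    + rewrite <- Im_Csum. exact (proj2 Hn).
  - intros [K1 K2].
    pose proof (proj1 (filterlim_locally _ _) K1) as H1.
    pose proof (proj1 (filterlim_locally _ _) K2) as H2.
    apply (proj2 (filterlim_locally (U := C_UniformSpace) (Csum u) s)). intros eps.
    generalize (filter_and _ _ (H1 eps) (H2 eps)).
    apply filter_imp. intros n Hn. rewrite <- Re_Csum, <- Im_Csum in Hn. exact Hn.
Qed.

Lemma is_Cseries_ext (u v : nat -> C) (s : C) :
  (forall n, u n = v n) -> is_Cseries u s -> is_Cseries v s.
Proof. exact (is_series_ext u v s). Qed.

Lemma is_Cseries_plus (u v : nat -> C) (s t : C) :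
  is_Cseries u s -> is_Cseries v t -> is_Cseries (fun n => u n + v n)%C (s + t)%C.
Proof. exact (is_series_plus u v s t). Qed.

Lemma is_Cseries_scal (u : nat -> C) (c s : C) :
  is_Cseries u s -> is_Cseries (fun n => c * u n)%C (c * s)%C.
Proof. exact (is_series_scal (K := C_AbsRing) (V := C_NormedModule) c u s). Qed.

Lemma is_Cseries_shift (u : nat -> C) (s : C) :
  u 0%nat = RtoC 0 -> is_Cseries (fun n => u (S n)) s -> is_Cseries u s.
Proof.
  intros H0 H. apply (is_series_decr_1 (K := C_AbsRing) (V := C_NormedModule)).
  rewrite H0. change (is_Cseries (fun k => u (S k)) (s + - RtoC 0)%C).
  now replace (s + - RtoC 0)%C with s by ring.
Qed.

Lemma is_Cseries_unshift (u : nat -> C) (s : C) :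
  u 0%nat = RtoC 0 -> is_Cseries u s -> is_Cseries (fun n => u (S n)) s.
Proof.
  intros H0 H. apply (is_series_incr_1 (K := C_AbsRing) (V := C_NormedModule)).
  rewrite H0. change (is_Cseries u (s + RtoC 0)%C).
  now replace (s + RtoC 0)%C with s by ring.
Qed.

Lemma is_Cseries_unique (u : nat -> C) (s t : C) :
  is_Cseries u s -> is_Cseries u t -> s = t.
Proof.
  rewrite !is_Cseries_iff. intros [A1 A2] [B1 B2].
  rewrite (surjective_pairing s), (surjective_pairing t). f_equal.
  - change (Re s = Re t). now rewrite <- (is_series_unique _ _ A1), <- (is_series_unique _ _ B1).
  - change (Im s = Im t). now rewrite <- (is_series_unique _ _ A2), <- (is_series_unique _ _ B2).
Qed.

Lemma Cmod_Csum_le (u : nat -> C) (b : nat -> R) (n : nat) :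
  (forall k, Cmod (u k) <= b k) -> Cmod (Csum u n) <= sum_n b n.
Proof.
  intros H. induction n as [|n IH]; [rewrite Csum_0, sum_O; apply H|].
  rewrite Csum_S, sum_Sn. eapply Rle_trans; [apply Cmod_triangle|].
  apply Rplus_le_compat; [exact IH|apply H].
Qed.

(** |z| is the largest real part among the rotations of z, which reduces bounds of
    moduli to linear inequalities. *)
Lemma Cmod_le_of_rotations (z : C) (B : R) :
  (forall c, Cmod c = 1 -> Re (c * z)%C <= B) -> Cmod z <= B.
Proof.
  intros H. destruct (Ceq_dec z (RtoC 0)) as [->|Hz].
  - rewrite Cmod_0. specialize (H (RtoC 1)). rewrite Cmult_0_r in H. simpl in H.
    apply H. apply Cmod_1.
  - assert (Hp : 0 < Cmod z) by now apply Cmod_gt_0.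
    specialize (H (Cconj z / RtoC (Cmod z))%C).
    assert (N : RtoC (Cmod z) <> RtoC 0).
    { intros E. apply RtoC_inj in E. lra. }
    assert (E : (Cconj z / RtoC (Cmod z) * z = RtoC (Cmod z))%C).
    { replace (Cconj z / RtoC (Cmod z) * z)%C with (z * Cconj z / RtoC (Cmod z))%C by (field; exact N).
      rewrite <- Cmod2_conj, RtoC_pow. simpl. field. exact N. }
    rewrite E in H. simpl in H. apply H.
    rewrite Cmod_div by exact N. rewrite Cmod_R, Rabs_pos_eq by lra.
    rewrite Cmod_conj. field. lra.
Qed.

Lemma is_Cseries_le (u : nat -> C) (b : nat -> R) (s : C) (B : R) :
  (forall n, Cmod (u n) <= b n) -> is_series b B -> is_Cseries u s -> Cmod s <= B.
Proof.
  intros Hb HB Hs. apply Cmod_le_of_rotations. intros c Hc.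
  apply (is_Cseries_scal u c s), is_Cseries_iff in Hs. destruct Hs as [Hr _].
  apply (is_lim_seq_le (sum_n (fun n => Re (c * u n)%C)) (sum_n b) (Re (c * s)%C) B);
    [|exact Hr|exact HB].
  intros n. rewrite !sum_n_Reals. apply sum_Rle. intros k _.
  eapply Rle_trans; [apply Rle_abs|]. eapply Rle_trans; [apply Rabs_Re_le|].
  rewrite Cmod_mult, Hc, Rmult_1_l. apply Hb.
Qed.

Lemma ex_series_Cmod (u : nat -> C) (b : nat -> R) :
  (forall n, Cmod (u n) <= b n) -> ex_series b -> exists s, is_Cseries u s.
Proof.
  intros Hb HB.
  assert (E1 : ex_series (fun n => Re (u n))).
  { apply (ex_series_le (K := R_AbsRing) (V := R_CompleteNormedModule)) with b; [|exact HB].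
    intros n. eapply Rle_trans; [apply Rabs_Re_le|apply Hb]. }
  assert (E2 : ex_series (fun n => Im (u n))).
  { apply (ex_series_le (K := R_AbsRing) (V := R_CompleteNormedModule)) with b; [|exact HB].
    intros n. eapply Rle_trans; [apply Rabs_Im_le|apply Hb]. }
  exists (Series (fun n => Re (u n)), Series (fun n => Im (u n))).
  apply is_Cseries_iff. split; apply Series_correct; assumption.
Qed.

Definition conv (a b : nat -> C) (n : nat) : C := Csum (fun k => a k * b (n - k)%nat)%C n.

Lemma conv_0 (a b : nat -> C) : conv a b 0 = (a 0%nat * b 0%nat)%C.
Proof. unfold conv. now rewrite Csum_0. Qed.

Lemma conv_1 (a b : nat -> C) : conv a b 1 = (a 0%nat * b 1%nat + a 1%nat * b 0%nat)%C.
Proof. unfold conv. now rewrite Csum_S, Csum_0. Qed.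

Lemma conv_S (a b : nat -> C) (n : nat) :
  conv a b (S n) = (a 0%nat * b (S n) + Csum (fun k => a (S k) * b (n - k)%nat) n)%C.
Proof. unfold conv. rewrite Csum_first, Nat.sub_0_r. reflexivity. Qed.

Lemma conv_ext (a b b' : nat -> C) (n : nat) :
  (forall k, (k <= n)%nat -> b k = b' k) -> conv a b n = conv a b' n.
Proof. intros H. apply Csum_ext. intros k _. rewrite H by lia. reflexivity. Qed.

(** Mertens' theorem, from its real version applied to the four products of real and
    imaginary parts. *)
Lemma is_Cseries_conv (u v : nat -> C) (s t : C) :
  ex_series (fun n => Cmod (u n)) -> ex_series (fun n => Cmod (v n)) ->
  is_Cseries u s -> is_Cseries v t -> is_Cseries (conv u v) (s * t)%C.
Proof.
  intros Au Av Hu Hv. apply is_Cseries_iff in Hu, Hv.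
  destruct Hu as [U1 U2], Hv as [V1 V2].
  assert (Dom : forall (w : nat -> C) (part : C -> R), (forall z, Rabs (part z) <= Cmod z) ->
     ex_series (fun n => Cmod (w n)) -> ex_series (fun n => Rabs (part (w n)))).
  { intros w part Hp Hw.
    apply (ex_series_le (K := R_AbsRing) (V := R_CompleteNormedModule)) with (fun n => Cmod (w n)); [|exact Hw].
    intros n. change (Rabs (Rabs (part (w n))) <= Cmod (w n)). rewrite Rabs_Rabsolu. apply Hp. }
  pose proof (Dom u Re Rabs_Re_le Au) as AU1. pose proof (Dom u Im Rabs_Im_le Au) as AU2.
  pose proof (Dom v Re Rabs_Re_le Av) as AV1. pose proof (Dom v Im Rabs_Im_le Av) as AV2.
  pose proof (is_series_mult _ _ _ _ U1 V1 AU1 AV1) as RR.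
  pose proof (is_series_mult _ _ _ _ U2 V2 AU2 AV2) as II.
  pose proof (is_series_mult _ _ _ _ U1 V2 AU1 AV2) as RI.
  pose proof (is_series_mult _ _ _ _ U2 V1 AU2 AV1) as IR.
  apply is_Cseries_iff. split.
  - pose proof (is_series_minus _ _ _ _ RR II) as H. revert H. apply is_series_ext. intros n.
    unfold conv. rewrite Re_Csum, sum_n_Reals. symmetry.
    exact (minus_sum (fun k => Re (u k) * Re (v (n - k)%nat)) (fun k => Im (u k) * Im (v (n - k)%nat)) n).
  - pose proof (is_series_plus _ _ _ _ RI IR) as H. revert H. apply is_series_ext. intros n.
    unfold conv. rewrite Im_Csum, sum_n_Reals. symmetry.
    exact (plus_sum (fun k => Re (u k) * Im (v (n - k)%nat)) (fun k => Im (u k) * Re (v (n - k)%nat)) n).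
Qed.

(** * Power series in the unit disk *)

(** The growth condition a_n = O(q^(-n)) for all q < 1, equivalent to a radius of
    convergence at least 1. *)
Definition subexp (a : nat -> C) : Prop :=
  forall q, 0 < q < 1 -> exists M, forall n, Cmod (a n) * q ^ n <= M.

Definition has_PS (a : nat -> C) (f : C -> C) : Prop :=
  forall z, in_disk z -> is_Cseries (fun n => a n * z ^ n)%C (f z).

Lemma has_PS_subexp (a : nat -> C) (f : C -> C) : has_PS a f -> subexp a.
Proof.
  intros H q Hq.
  assert (D : in_disk (RtoC q)) by (unfold in_disk; rewrite Cmod_R, Rabs_pos_eq; lra).
  specialize (H _ D). apply is_Cseries_iff in H. destruct H as [H1 H2].
  assert (L1 := ex_series_lim_0 _ (ex_intro _ _ H1)).
  assert (L2 := ex_series_lim_0 _ (ex_intro _ _ H2)).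
  destruct (filterlim_bounded (K := R_AbsRing) (V := R_NormedModule) _ (ex_intro _ 0 L1)) as [M1 B1].
  destruct (filterlim_bounded (K := R_AbsRing) (V := R_NormedModule) _ (ex_intro _ 0 L2)) as [M2 B2].
  exists (M1 + M2). intros n. specialize (B1 n). specialize (B2 n).
  change (Rabs (Re (a n * RtoC q ^ n)%C) <= M1) in B1.
  change (Rabs (Im (a n * RtoC q ^ n)%C) <= M2) in B2.
  pose proof (Cmod_le_Rabs (a n * RtoC q ^ n)%C) as B.
  rewrite Cmod_mult, Cmod_pow, Cmod_R, Rabs_pos_eq in B by lra. lra.
Qed.

Lemma subexp_abs (a : nat -> C) (r : R) :
  subexp a -> 0 <= r < 1 -> ex_series (fun n => Cmod (a n) * r ^ n).
Proof.
  intros Ha Hr. pose (q := (1 + r) / 2).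
  assert (Hq : 0 < q < 1) by (unfold q; lra). assert (Hrq : r < q) by (unfold q; lra).
  destruct (Ha q Hq) as [M HM].
  apply (ex_series_le (K := R_AbsRing) (V := R_CompleteNormedModule)) with (fun n => M * (r / q) ^ n).
  - intros n. change (Rabs (Cmod (a n) * r ^ n) <= M * (r / q) ^ n).
    assert (P1 := pow_le r n (proj1 Hr)). assert (P2 := pow_lt q n (proj1 Hq)).
    pose proof (Cmod_ge_0 (a n)). rewrite Rabs_pos_eq by nra.
    unfold Rdiv. rewrite Rpow_mult_distr, pow_inv.
    replace (Cmod (a n) * r ^ n) with (Cmod (a n) * q ^ n * (r ^ n * / q ^ n)) by (field; lra).
    apply Rmult_le_compat_r; [|apply HM].
    apply Rmult_le_pos; [exact P1|]. left. now apply Rinv_0_lt_compat.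
  - apply (ex_series_scal (K := R_AbsRing) (V := R_NormedModule) M).
    apply ex_series_geom. unfold Rdiv. rewrite Rabs_pos_eq.
    + apply Rmult_lt_reg_r with q; [lra|]. rewrite Rmult_assoc, Rinv_l; lra.
    + apply Rmult_le_pos; [lra|]. left. apply Rinv_0_lt_compat; lra.
Qed.

Lemma subexp_abs_at (a : nat -> C) (z : C) :
  subexp a -> in_disk z -> ex_series (fun n => Cmod (a n * z ^ n)%C).
Proof.
  intros Ha Hz. apply ex_series_ext with (fun n => Cmod (a n) * Cmod z ^ n).
  - intros n. now rewrite Cmod_mult, Cmod_pow.
  - apply subexp_abs; [exact Ha|]. split; [apply Cmod_ge_0|exact Hz].
Qed.

Definition power_sum (a : nat -> C) (z : C) : C :=
  (Series (fun n => Re (a n * z ^ n)%C), Series (fun n => Im (a n * z ^ n)%C)).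

Lemma has_PS_power_sum (a : nat -> C) : subexp a -> has_PS a (power_sum a).
Proof.
  intros Ha z Hz.
  destruct (ex_series_Cmod (fun n => a n * z ^ n)%C _ (fun n => Rle_refl _)
              (subexp_abs_at a z Ha Hz)) as [s Hs].
  apply is_Cseries_iff in Hs. destruct Hs as [H1 H2].
  apply is_Cseries_iff. split; apply Series_correct; eexists; eassumption.
Qed.

Lemma has_PS_plus (a b : nat -> C) (f g : C -> C) :
  has_PS a f -> has_PS b g -> has_PS (fun n => a n + b n)%C (fun z => f z + g z)%C.
Proof.
  intros Hf Hg z Hz. eapply is_Cseries_ext with (2 := is_Cseries_plus _ _ _ _ (Hf z Hz) (Hg z Hz)).
  intros n. simpl. ring.
Qed.

Lemma has_PS_scal (a : nat -> C) (f : C -> C) (c : C) :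
  has_PS a f -> has_PS (fun n => c * a n)%C (fun z => c * f z)%C.
Proof.
  intros Hf z Hz. eapply is_Cseries_ext with (2 := is_Cseries_scal _ c _ (Hf z Hz)).
  intros n. simpl. ring.
Qed.

Lemma conv_pow (a b : nat -> C) (z : C) (n : nat) :
  conv (fun k => a k * z ^ k)%C (fun k => b k * z ^ k)%C n = (conv a b n * z ^ n)%C.
Proof.
  unfold conv.
  transitivity (Csum (fun k => a k * b (n - k)%nat * z ^ n)%C n).
  - apply Csum_ext. intros k Hk.
    replace (z ^ n)%C with (z ^ k * z ^ (n - k))%C; [ring|].
    rewrite <- Cpow_add_r. f_equal. lia.
  - exact (sum_n_mult_r (K := C_Ring) (z ^ n)%C (fun k => a k * b (n - k)%nat)%C n).
Qed.

Lemma has_PS_mult (a b : nat -> C) (f g : C -> C) :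
  has_PS a f -> has_PS b g -> has_PS (conv a b) (fun z => f z * g z)%C.
Proof.
  intros Hf Hg z Hz.
  eapply is_Cseries_ext with (2 := is_Cseries_conv _ _ _ _
    (subexp_abs_at a z (has_PS_subexp a f Hf) Hz)
    (subexp_abs_at b z (has_PS_subexp b g Hg) Hz) (Hf z Hz) (Hg z Hz)).
  intros n. apply conv_pow.
Qed.

Lemma has_PS_mult_id (a : nat -> C) (f : C -> C) :
  has_PS a f ->
  has_PS (fun n => match n with O => RtoC 0 | S m => a m end) (fun z => z * f z)%C.
Proof.
  intros Hf z Hz. apply is_Cseries_shift; [simpl; ring|].
  eapply is_Cseries_ext with (2 := is_Cseries_scal _ z _ (Hf z Hz)).
  intros n. simpl. ring.
Qed.

Lemma has_PS_poly (c : nat -> C) (N : nat) :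
  has_PS (fun n => if Nat.leb n N then c n else RtoC 0)
         (fun z => Csum (fun k => c k * z ^ k)%C N).
Proof.
  intros z Hz. set (u := fun n => ((if Nat.leb n N then c n else RtoC 0) * z ^ n)%C).
  assert (E : forall m, (N <= m)%nat -> Csum u m = Csum (fun k => c k * z ^ k)%C N :> C).
  { intros m Hm. induction Hm as [|m Hm IH].
    - apply Csum_ext. intros k Hk. unfold u. rewrite (proj2 (Nat.leb_le k N) Hk). reflexivity.
    - rewrite Csum_S, IH. unfold u. rewrite (proj2 (Nat.leb_gt (S m) N)) by lia. ring. }
  apply (proj2 (filterlim_locally (U := C_UniformSpace) (Csum u) _)).
  intros eps. exists N. intros m Hm. rewrite E by exact Hm. apply ball_center.
Qed.

Lemma has_PS_at_0 (a : nat -> C) (f : C -> C) : has_PS a f -> f (RtoC 0) = a 0%nat.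
Proof.
  intros H. assert (D : in_disk (RtoC 0)) by (unfold in_disk; rewrite Cmod_0; lra).
  pose proof (has_PS_poly a 0 _ D) as P. cbv beta in P. rewrite Csum_0 in P.
  replace (a 0%nat) with (a 0%nat * RtoC 0 ^ 0)%C by (simpl; ring).
  refine (is_Cseries_unique _ _ _ (H _ D) _).
  eapply is_Cseries_ext with (2 := P). intros [|n]; simpl; ring.
Qed.

Lemma has_PS_tail (c : nat -> C) (f : C -> C) (r eps : R) :
  has_PS c f -> 0 <= r < 1 -> 0 < eps ->
  exists N0, forall N, (N0 <= N)%nat -> forall z, Cmod z = r ->
    Cmod (f z - Csum (fun j => c j * z ^ j) N)%C <= eps.
Proof.
  intros Hf Hr He. destruct (subexp_abs c r (has_PS_subexp c f Hf) Hr) as [B HB].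
  destruct (proj1 (filterlim_locally _ _) HB (mkposreal eps He)) as [N0 HN].
  exists N0. intros N HNN z Hz.
  assert (Dz : in_disk z) by (unfold in_disk; lra).
  assert (H1 : is_series (fun k => Cmod (c (S N + k)%nat) * r ^ (S N + k))
                 (B - sum_n (fun j => Cmod (c j) * r ^ j) N)).
  { apply (is_series_incr_n (K := R_AbsRing) (V := R_NormedModule)
             (fun j => Cmod (c j) * r ^ j) (S N)); [lia|]. simpl pred.
    change (is_series (fun j => Cmod (c j) * r ^ j)
      (B - sum_n (fun j => Cmod (c j) * r ^ j) N + sum_n (fun j => Cmod (c j) * r ^ j) N)).
    assert (E : forall s : R, B - s + s = B) by (intros s; ring). now rewrite E. }
  assert (H2 : is_Cseries (fun k => c (S N + k)%nat * z ^ (S N + k))%C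
                 (f z - Csum (fun j => c j * z ^ j) N)%C).
  { apply (is_series_incr_n (K := C_AbsRing) (V := C_NormedModule)
             (fun j => c j * z ^ j)%C (S N)); [lia|]. simpl pred.
    change (is_Cseries (fun j => c j * z ^ j)%C
      (f z - Csum (fun j => c j * z ^ j) N + Csum (fun j => c j * z ^ j) N)%C).
    assert (E : forall s, (f z - s + s)%C = f z) by (intros s; ring). rewrite E. exact (Hf z Dz). }
  refine (Rle_trans _ _ _ (is_Cseries_le _ _ _ _ _ H1 H2) _).
  - intros k. rewrite Cmod_mult, Cmod_pow, Hz. lra.
  - specialize (HN N HNN). change (Rabs (sum_n (fun j => Cmod (c j) * r ^ j) N - B) < eps) in HN.
    apply Rabs_def2 in HN. lra.
Qed.

(** Any s < 1 absorbs the factor n, as n s^n is bounded by Bernoulli's inequality.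
    *)
Lemma subexp_INR (a : nat -> C) : subexp a -> subexp (fun n => RtoC (INR n) * a n)%C.
Proof.
  intros Ha q Hq. pose (p := (1 + q) / 2).
  assert (Hp : q < p < 1) by (unfold p; lra).
  destruct (Ha p ltac:(lra)) as [M HM]. pose (x := p / q - 1).
  assert (Ep : p = q * (1 + x)) by (unfold x; field; lra).
  assert (Px : 0 < x) by nra.
  exists (M / x). intros n.
  rewrite Cmod_mult, Cmod_R, Rabs_pos_eq by apply pos_INR.
  specialize (HM n). rewrite Ep, Rpow_mult_distr in HM.
  assert (B : 1 + INR n * x <= (1 + x) ^ n) by (apply poly; exact Px).
  pose proof (pos_INR n). pose proof (Cmod_ge_0 (a n)). pose proof (pow_lt q n (proj1 Hq)).
  apply Rmult_le_reg_r with x; [exact Px|].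
  replace (M / x * x) with M by (field; lra).
  replace (INR n * Cmod (a n) * q ^ n * x) with (Cmod (a n) * q ^ n * (INR n * x)) by ring.
  apply Rle_trans with (2 := HM). rewrite Rmult_assoc.
  apply Rmult_le_compat_l; [assumption|]. apply Rmult_le_compat_l; lra.
Qed.

Lemma subexp_shift (a : nat -> C) : subexp a -> subexp (fun n => a (S n)).
Proof.
  intros Ha q Hq. destruct (Ha q Hq) as [M HM]. exists (M / q). intros n.
  specialize (HM (S n)). simpl in HM. apply Rmult_le_reg_r with q; [lra|].
  replace (M / q * q) with M by (field; lra). lra.
Qed.

Definition derive_coef (a : nat -> C) (n : nat) : C := (RtoC (INR (S n)) * a (S n))%C.

Lemma subexp_derive_coef (a : nat -> C) : subexp a -> subexp (derive_coef a).
Proof. intros Ha. exact (subexp_shift _ (subexp_INR a Ha)). Qed.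

Lemma has_PS_derive_coef (a : nat -> C) (f : C -> C) :
  has_PS a f -> has_PS (derive_coef a) (power_sum (derive_coef a)).
Proof. intros Hf. apply has_PS_power_sum, subexp_derive_coef. now apply has_PS_subexp in Hf. Qed.

(** Second-order Taylor remainder of a power. The factor rho^2 on the left replaces
    an exponent n - 2 on the right. *)
Lemma pow_taylor (z h : C) (rho : R) (n : nat) :
  Cmod z <= rho -> Cmod (z + h)%C <= rho ->
  rho ^ 2 * Cmod ((z + h) ^ n - z ^ n - RtoC (INR n) * z ^ (pred n) * h)%C
    <= INR n ^ 2 * rho ^ n * Cmod h ^ 2.
Proof.
  intros Hz Hzh. assert (Pr : 0 <= rho) by (pose proof (Cmod_ge_0 z); lra).
  induction n as [|n IH].
  - simpl. replace (RtoC 1 - RtoC 1 - RtoC 0 * RtoC 1 * h)%C with (RtoC 0) by ring.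
    rewrite Cmod_0. lra.
  - set (E := ((z + h) ^ n - z ^ n - RtoC (INR n) * z ^ (pred n) * h)%C) in *.
    assert (Eq : ((z + h) ^ S n - z ^ S n - RtoC (INR (S n)) * z ^ (pred (S n)) * h)%C
        = ((z + h) * E + RtoC (INR n) * z ^ (pred n) * (h * h))%C).
    { rewrite S_INR, RtoC_plus. unfold E. destruct n as [|n]; simpl; ring. }
    rewrite Eq. clear Eq.
    assert (P2 : 0 <= rho ^ 2) by (apply pow_le; exact Pr).
    assert (T1 : rho ^ 2 * Cmod ((z + h) * E)%C <= rho * (INR n ^ 2 * rho ^ n * Cmod h ^ 2)).
    { rewrite Cmod_mult.
      replace (rho ^ 2 * (Cmod (z + h)%C * Cmod E)) with (Cmod (z + h)%C * (rho ^ 2 * Cmod E)) by ring.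
      apply Rmult_le_compat; try assumption; [apply Cmod_ge_0|].
      apply Rmult_le_pos; [exact P2|apply Cmod_ge_0]. }
    assert (T2 : rho ^ 2 * Cmod (RtoC (INR n) * z ^ (pred n) * (h * h))%C
                 <= INR n * rho ^ S n * Cmod h ^ 2).
    { rewrite !Cmod_mult, Cmod_R, Rabs_pos_eq, Cmod_pow by apply pos_INR.
      destruct n as [|n]; [simpl; lra|]. simpl pred.
      assert (Cmod z ^ n <= rho ^ n) by (apply pow_incr; split; [apply Cmod_ge_0|exact Hz]).
      replace (rho ^ 2 * (INR (S n) * Cmod z ^ n * (Cmod h * Cmod h)))
        with (INR (S n) * rho ^ 2 * Cmod h ^ 2 * Cmod z ^ n) by ring.
      replace (INR (S n) * rho ^ S (S n) * Cmod h ^ 2)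
        with (INR (S n) * rho ^ 2 * Cmod h ^ 2 * rho ^ n) by (simpl; ring).
      apply Rmult_le_compat_l; [|assumption].
      repeat apply Rmult_le_pos; try apply pos_INR; try apply pow_le; try lra; try apply Cmod_ge_0. }
    eapply Rle_trans; [apply Rmult_le_compat_l; [exact P2|apply Cmod_triangle]|].
    rewrite Rmult_plus_distr_l. eapply Rle_trans; [apply Rplus_le_compat; [exact T1|exact T2]|].
    rewrite S_INR.
    replace (rho * (INR n ^ 2 * rho ^ n * Cmod h ^ 2) + INR n * rho ^ S n * Cmod h ^ 2)
      with ((INR n ^ 2 + INR n) * (rho ^ S n * Cmod h ^ 2)) by (simpl; ring).
    replace ((INR n + 1) ^ 2 * rho ^ S n * Cmod h ^ 2)
      with ((INR n + 1) ^ 2 * (rho ^ S n * Cmod h ^ 2)) by ring.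
    apply Rmult_le_compat_r.
    + apply Rmult_le_pos; apply pow_le; [exact Pr|apply Cmod_ge_0].
    + pose proof (pos_INR n). nra.
Qed.

(** Summing [pow_taylor] against the coefficients bounds the remainder of f by a
    constant times |h|^2. *)
Lemma has_PS_derive (a : nat -> C) (f : C -> C) (z : C) :
  has_PS a f -> in_disk z -> is_Cderive f z (power_sum (derive_coef a) z).
Proof.
  intros Hf Hz. pose proof (has_PS_subexp a f Hf) as Sa.
  pose proof (has_PS_derive_coef a f Hf z Hz) as Hd. set (l := power_sum (derive_coef a) z) in *.
  assert (Hd' : is_Cseries (fun n => RtoC (INR n) * a n * z ^ (pred n))%C l).
  { apply is_Cseries_shift; [simpl; ring|].
    eapply is_Cseries_ext with (2 := Hd). intros n. reflexivity. }
  (* All points z + h considered stay in the disk of radius rho < 1, where the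
     second-order remainders are summable. *)
  pose (rho := (1 + Cmod z) / 2). unfold in_disk in Hz. pose proof (Cmod_ge_0 z) as Pz.
  assert (Hr : Cmod z < rho < 1) by (unfold rho; lra).
  destruct (subexp_abs _ rho (subexp_INR _ (subexp_INR a Sa)) ltac:(lra)) as [B HB].
  apply is_Cderive_eps. intros eps.
  assert (PB : 0 <= B).
  { apply (is_Cseries_le (fun _ => RtoC 0) _ (RtoC 0) B) in HB.
    - now rewrite Cmod_0 in HB.
    - intros n. rewrite Cmod_0. apply Rmult_le_pos; [apply Cmod_ge_0|apply pow_le; lra].
    - pose proof (is_Cseries_scal _ (RtoC 0) _ Hd') as K. rewrite Cmult_0_l in K.
      eapply is_Cseries_ext with (2 := K). intros n. simpl. ring. }
  pose (K := B / rho ^ 2 + 1).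
  assert (PK : 0 < K).
  { assert (0 <= B / rho ^ 2); [|unfold K; lra].
    apply Rmult_le_pos; [exact PB|]. left. apply Rinv_0_lt_compat, pow_lt. lra. }
  exists (Rmin (rho - Cmod z) (eps / K)). split.
  { apply Rmin_pos; [lra|]. apply Rdiv_lt_0_compat; [apply cond_pos|exact PK]. }
  intros h Hh. pose proof (Rmin_l (rho - Cmod z) (eps / K)). pose proof (Rmin_r (rho - Cmod z) (eps / K)).
  assert (Dzh : Cmod (z + h)%C <= rho) by (pose proof (Cmod_triangle z h); lra).
  assert (S3 : is_Cseries (fun n => a n * ((z + h) ^ n - z ^ n - RtoC (INR n) * z ^ (pred n) * h))%C
                 (f (z + h) - f z - l * h)%C).
  { pose proof (Hf (z + h)%C ltac:(unfold in_disk; lra)) as A1.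
    pose proof (is_Cseries_scal _ (RtoC (-1)) _ (Hf z Hz)) as A2.
    pose proof (is_Cseries_scal _ (- h)%C _ Hd') as A3.
    pose proof (is_Cseries_plus _ _ _ _ (is_Cseries_plus _ _ _ _ A1 A2) A3) as A4.
    replace (f (z + h) - f z - l * h)%C with (f (z + h) + RtoC (-1) * f z + - h * l)%C by ring.
    eapply is_Cseries_ext with (2 := A4). intros n. simpl. ring. }
  assert (Bd : rho ^ 2 * Cmod (f (z + h) - f z - l * h)%C <= B * Cmod h ^ 2).
  { pose proof (is_Cseries_scal _ (RtoC (rho ^ 2)) _ S3) as S4.
    assert (E : Cmod (RtoC (rho ^ 2) * (f (z + h) - f z - l * h))%C
                = rho ^ 2 * Cmod (f (z + h) - f z - l * h)%C).
    { rewrite Cmod_mult, Cmod_R, Rabs_pos_eq; [reflexivity|]. apply pow_le; lra. }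
    rewrite <- E.
    apply (is_Cseries_le _ (fun n => (Cmod (RtoC (INR n) * (RtoC (INR n) * a n))%C * rho ^ n) * Cmod h ^ 2)
             _ _) with (3 := S4).
    - intros n. rewrite !Cmod_mult, !Cmod_R, !(Rabs_pos_eq (INR n)), Rabs_pos_eq
        by (try apply pos_INR; apply pow_le; lra).
      pose proof (pow_taylor z h rho n ltac:(lra) Dzh) as T.
      apply Rmult_le_compat_l with (r := Cmod (a n)) in T; [|apply Cmod_ge_0]. lra.
    - pose proof (is_series_scal (K := R_AbsRing) (V := R_NormedModule) (Cmod h ^ 2) _ _ HB) as HB2.
      replace (B * Cmod h ^ 2) with (Cmod h ^ 2 * B) by ring.
      revert HB2. apply is_series_ext. intros n. apply Rmult_comm. }
  assert (Bd2 : Cmod (f (z + h) - f z - l * h)%C <= K * Cmod h ^ 2).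
  { apply Rmult_le_reg_l with (rho ^ 2); [apply pow_lt; lra|].
    eapply Rle_trans; [exact Bd|].
    replace (rho ^ 2 * (K * Cmod h ^ 2)) with (B * Cmod h ^ 2 + rho ^ 2 * Cmod h ^ 2)
      by (unfold K; field; lra).
    assert (0 <= rho ^ 2 * Cmod h ^ 2) by (apply Rmult_le_pos; apply pow_le; [lra|apply Cmod_ge_0]).
    lra. }
  assert (Kh : K * Cmod h <= eps).
  { assert (Hh2 : Cmod h <= eps / K) by lra.
    apply Rmult_le_compat_l with (r := K) in Hh2; [|lra].
    replace (K * (eps / K)) with (pos eps) in Hh2 by (field; lra). exact Hh2. }
  pose proof (Cmod_ge_0 h). nra.
Qed.

Definition antider_coef (a : nat -> C) (n : nat) : C :=
  match n with O => RtoC 0 | S m => (RtoC (/ INR (S m)) * a m)%C end.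

Lemma derive_coef_antider_coef (a : nat -> C) (n : nat) : derive_coef (antider_coef a) n = a n.
Proof.
  unfold derive_coef, antider_coef. rewrite Cmult_assoc, <- RtoC_mult, Rinv_r by (apply not_0_INR; lia). ring.
Qed.

Lemma subexp_antider_coef (a : nat -> C) : subexp a -> subexp (antider_coef a).
Proof.
  intros Ha q Hq. destruct (Ha q Hq) as [M HM]. exists M.
  assert (PM : 0 <= M). { specialize (HM 0%nat). simpl in HM. pose proof (Cmod_ge_0 (a 0%nat)). lra. }
  intros [|n]; unfold antider_coef; [rewrite Cmod_0; lra|].
  assert (P : 1 <= INR (S n)) by (apply (le_INR 1); lia).
  assert (Q : 0 < / INR (S n) <= 1).
  { split; [apply Rinv_0_lt_compat; lra|]. rewrite <- Rinv_1. apply Rinv_le_contravar; lra. }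
  rewrite Cmod_mult, Cmod_R, Rabs_pos_eq by lra. simpl pow.
  specialize (HM n). assert (0 <= Cmod (a n) * q ^ n).
  { apply Rmult_le_pos; [apply Cmod_ge_0|apply pow_le; lra]. }
  replace (/ INR (S n) * Cmod (a n) * (q * q ^ n)) with ((/ INR (S n) * q) * (Cmod (a n) * q ^ n)) by ring.
  assert (0 <= / INR (S n) * q <= 1) by nra. nra.
Qed.

(** * Exponential of a power series *)

(** Course-of-values recursion for sequences; it produces the coefficients of
    exponentials and reciprocals. *)
Lemma recursion_exists (F : nat -> (nat -> C) -> C) :
  (forall n a b, (forall k, (k < n)%nat -> a k = b k) -> F n a = F n b) ->
  exists a, forall n, a n = F n a.
Proof.
  intros HF.
  (* The k-th iterate of the functional is already correct below index k. *)
  pose (A := fun k => Nat.iter k (fun a n => F n a) (fun _ => RtoC 0)).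
  assert (AS : forall k n, A (S k) n = F n (A k)) by reflexivity.
  assert (St : forall N n k m, (n < N)%nat -> (n < k)%nat -> (n < m)%nat -> A k n = A m n).
  { induction N as [|N IH]; intros n k m HN Hk Hm; [lia|].
    destruct k as [|k], m as [|m]; try lia. rewrite !AS. apply HF. intros j Hj.
    apply IH; lia. }
  exists (fun n => A (S n) n). intros n. rewrite AS. apply HF. intros k Hk.
  apply (St (S k)); lia.
Qed.

(** The growth factors 1 + M / (n + 1) tend to 1, so s grows slower than any
    geometric sequence of ratio above 1. *)
Lemma slow_growth (s : nat -> R) (M t : R) :
  0 <= M -> 1 < t -> 0 <= s 0%nat ->
  (forall n, s n <= s (S n) <= s n * (1 + M / INR (S n))) ->
  exists K, forall n, s n <= K * t ^ n.
Proof.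
  intros HM Ht H0 Hs.
  assert (Pos : forall n, 0 <= s n).
  { induction n as [|n IH]; [exact H0|]. destruct (Hs n). lra. }
  (* From N on, each step multiplies by at most t. *)
  destruct (INR_unbounded (M / (t - 1))) as [N HN].
  assert (Late : forall m, s (N + m)%nat <= s N * t ^ m).
  { induction m as [|m IH]; [rewrite Nat.add_0_r; simpl; lra|].
    rewrite Nat.add_succ_r. eapply Rle_trans; [apply Hs|].
    assert (Q : M / INR (S (N + m)) <= t - 1).
    { assert (P : 0 < INR (S (N + m))) by (apply lt_0_INR; lia).
      assert (L : INR N <= INR (S (N + m))) by (apply le_INR; lia).
      apply Rmult_le_reg_r with (INR (S (N + m))); [exact P|].
      unfold Rdiv. rewrite Rmult_assoc, Rinv_l, Rmult_1_r by lra.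
      apply Rgt_lt, Rlt_le, Rmult_le_compat_r with (r := t - 1) in HN; [|lra].
      replace (M / (t - 1) * (t - 1)) with M in HN by (field; lra).
      eapply Rle_trans; [exact HN|]. rewrite (Rmult_comm (t - 1)). apply Rmult_le_compat_r; lra. }
    change (t ^ S m) with (t * t ^ m). pose proof (Pos (N + m)%nat). pose proof (pow_le t m ltac:(lra)).
    apply Rle_trans with (s (N + m)%nat * t); [apply Rmult_le_compat_l; lra|].
    replace (s N * (t * t ^ m)) with (s N * t ^ m * t) by ring.
    apply Rmult_le_compat_r; lra. }
  exists (s N). intros n. destruct (Nat.le_gt_cases N n) as [L|G].
  - replace n with (N + (n - N))%nat at 1 by lia.
    eapply Rle_trans; [apply Late|]. apply Rmult_le_compat_l; [apply Pos|].
    apply Rle_pow; [lra|lia].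
  - assert (Mono : forall k j, (j <= k)%nat -> s j <= s k).
    { intros k j Hjk. induction Hjk as [|k _ IH]; [lra|]. destruct (Hs k). lra. }
    apply Rle_trans with (s N); [apply Mono; lia|].
    pose proof (Pos N). pose proof (pow_R1_Rle t n ltac:(lra)). nra.
Qed.

Lemma has_PS_ext (a b : nat -> C) (f g : C -> C) :
  (forall n, a n = b n) -> (forall z, in_disk z -> f z = g z) ->
  has_PS a f -> has_PS b g.
Proof.
  intros Hab Hfg H z Hz. rewrite <- Hfg by exact Hz.
  apply is_Cseries_ext with (2 := H z Hz). intros n. now rewrite Hab.
Qed.

(** The equation G' = L' G determines the coefficients of G = exp L. In it the
    coefficient of index n + 1 is divided by n + 1, which by [slow_growth] keeps the
    radius of convergence at 1, and [ODE_exp] identifies the sum. *)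
Lemma has_PS_Cexp (l : nat -> C) (L : C -> C) :
  has_PS l L -> l 0%nat = RtoC 0 ->
  exists G, G 0%nat = RtoC 1 /\ (forall n, derive_coef G n = conv (derive_coef l) G n) /\
    has_PS G (fun z => Cexp (L z)).
Proof.
  intros HL l0. pose proof (has_PS_subexp l L HL) as Sl.
  destruct (recursion_exists (fun n a => match n with
     | O => RtoC 1
     | S m => (RtoC (/ INR (S m)) * Csum (fun k => derive_coef l k * a (m - k)%nat) m)%C end)) as [G HG].
  { intros [|m] a b Hab; [reflexivity|]. f_equal. apply Csum_ext. intros k Hk.
    rewrite Hab by lia. reflexivity. }
  assert (Rec : forall n, derive_coef G n = conv (derive_coef l) G n).
  { intros n. unfold derive_coef at 1. rewrite (HG (S n)). fold (conv (derive_coef l) G n).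
    rewrite Cmult_assoc, <- RtoC_mult, Rinv_r by (apply not_0_INR; lia). ring. }
  assert (SG : subexp G).
  { intros q Hq. pose (p := (1 + q) / 2). assert (Hp : q < p < 1) by (unfold p; lra).
    destruct (subexp_derive_coef l Sl p ltac:(lra)) as [M HM].
    assert (PM : 0 <= M).
    { specialize (HM 0%nat). simpl in HM. pose proof (Cmod_ge_0 (derive_coef l 0)). lra. }
    pose (A := fun n => Cmod (G n) * p ^ n).
    assert (PA : forall n, 0 <= A n).
    { intros n. apply Rmult_le_pos; [apply Cmod_ge_0|apply pow_le; lra]. }
    (* The recursion bounds (n + 1) A (n + 1) by the sum of the earlier terms. *)
    assert (Step : forall n, INR (S n) * A (S n) <= M * sum_n A n).
    { intros n. unfold A at 1.
      replace (INR (S n) * (Cmod (G (S n)) * p ^ S n)) with (Cmod (derive_coef G n) * p ^ n * p).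
      2:{ unfold derive_coef. rewrite Cmod_mult, Cmod_R, Rabs_pos_eq by apply pos_INR. simpl. ring. }
      assert (B : Cmod (derive_coef G n) * p ^ n <= M * sum_n A n).
      { rewrite Rec. rewrite <- (Rabs_pos_eq (p ^ n)) by (apply pow_le; lra).
        rewrite <- Cmod_R, RtoC_pow, <- Cmod_mult, <- conv_pow.
        unfold conv. eapply Rle_trans.
        { apply Cmod_Csum_le with (b := fun k => M * A (n - k)%nat). intros k.
          rewrite !Cmod_mult, !Cmod_pow, !Cmod_R, !(Rabs_pos_eq p) by lra.
          unfold A. apply Rmult_le_compat; [apply Rmult_le_pos| apply PA| apply HM|apply Rle_refl].
          apply Cmod_ge_0. apply pow_le; lra. }
        apply Req_le. rewrite !sum_n_Reals, <- (sum_f_R0_skip A n), scal_sum.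
        apply sum_eq. intros k _. ring. }
      assert (0 <= Cmod (derive_coef G n) * p ^ n)
        by (apply Rmult_le_pos; [apply Cmod_ge_0|apply pow_le; lra]).
      nra. }
    destruct (slow_growth (sum_n A) M (p / q)) as [K HK].
    - exact PM.
    - apply Rmult_lt_reg_r with q; [lra|]. unfold Rdiv. rewrite Rmult_assoc, Rinv_l; lra.
    - rewrite sum_O. apply PA.
    - intros n. rewrite sum_Sn. change (plus (sum_n A n) (A (S n))) with (sum_n A n + A (S n)).
      pose proof (PA (S n)). split; [lra|].
      assert (P : 0 < INR (S n)) by (apply lt_0_INR; lia).
      apply Rmult_le_reg_l with (INR (S n)); [exact P|].
      replace (INR (S n) * (sum_n A n * (1 + M / INR (S n))))
        with (INR (S n) * sum_n A n + M * sum_n A n) by (field; lra).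
      specialize (Step n). lra.
    - exists K. intros n. specialize (HK n).
      assert (Q : 0 < q ^ n) by (apply pow_lt; lra).
      assert (An : A n <= sum_n A n).
      { destruct n as [|n]; [rewrite sum_O; lra|]. rewrite sum_Sn.
        change (A (S n) <= sum_n A n + A (S n)).
        assert (0 <= sum_n A n); [|lra].
        rewrite sum_n_Reals. apply cond_pos_sum. exact PA. }
      unfold Rdiv in HK. rewrite Rpow_mult_distr, pow_inv in HK.
      apply Rmult_le_reg_r with (p ^ n * / q ^ n).
      { apply Rmult_lt_0_compat; [apply pow_lt; lra|now apply Rinv_0_lt_compat]. }
      replace (Cmod (G n) * q ^ n * (p ^ n * / q ^ n)) with (A n) by (unfold A; field; lra).
      lra. }
  assert (G0 : G 0%nat = RtoC 1) by apply HG.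
  exists G. split; [exact G0|]. split; [exact Rec|].
  pose proof (has_PS_power_sum G SG) as PG.
  apply has_PS_ext with G (power_sum G); [reflexivity| |exact PG].
  intros z Hz. symmetry. apply (ODE_exp (power_sum G) L (power_sum (derive_coef l))); try exact Hz.
  - intros w Hw. now apply has_PS_derive.
  - intros w Hw.
    replace (power_sum (derive_coef l) w * power_sum G w)%C with (power_sum (derive_coef G) w);
      [now apply has_PS_derive|].
    refine (is_Cseries_unique _ _ _ (has_PS_derive_coef G _ PG w Hw) _).
    eapply is_Cseries_ext
      with (2 := has_PS_mult _ _ _ _ (has_PS_derive_coef l L HL) PG w Hw).
    intros n. simpl. now rewrite Rec.
  - now rewrite (has_PS_at_0 l L HL).
  - now rewrite (has_PS_at_0 G _ PG).
Qed.

(** * Coefficients of functions with positive real part *)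

Lemma geometric_Csum (w : C) (n : nat) :
  ((w - RtoC 1) * Csum (fun k => w ^ k) n)%C = (w ^ S n - RtoC 1)%C.
Proof.
  induction n as [|n IH]; [rewrite Csum_0; simpl; ring|].
  rewrite Csum_S, Cmult_plus_distr_l, IH. simpl. ring.
Qed.

Definition unity_root (M : nat) : C := (cos (2 * PI / INR M), sin (2 * PI / INR M)).

Lemma unity_root_pow (M k : nat) :
  (unity_root M ^ k)%C = (cos (INR k * (2 * PI / INR M)), sin (INR k * (2 * PI / INR M))).
Proof.
  induction k as [|k IH].
  - simpl INR. rewrite Rmult_0_l, cos_0, sin_0. reflexivity.
  - rewrite S_INR, Rmult_plus_distr_r, Rmult_1_l, cos_plus, sin_plus.
    rewrite Cpow_S, IH. unfold unity_root, Cmult; simpl. f_equal; ring.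
Qed.

Lemma unity_root_conj (M : nat) : (unity_root M * Cconj (unity_root M) = RtoC 1)%C.
Proof.
  unfold unity_root, Cmult, Cconj, RtoC; simpl. f_equal; [|ring].
  pose proof (sin2_cos2 (2 * PI / INR M)) as H. unfold Rsqr in H. lra.
Qed.

Lemma unity_root_order (M : nat) : (0 < M)%nat -> (unity_root M ^ M = RtoC 1)%C.
Proof.
  intros HM. rewrite unity_root_pow.
  replace (INR M * (2 * PI / INR M)) with (2 * PI) by (field; apply not_0_INR; lia).
  now rewrite cos_2PI, sin_2PI.
Qed.

Lemma unity_root_primitive (M k : nat) : (0 < k < M)%nat -> (unity_root M ^ k <> RtoC 1)%C.
Proof.
  intros Hk E. rewrite unity_root_pow in E. apply (f_equal fst) in E. simpl in E.
  assert (P : 0 < INR k / INR M < 1).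
  { assert (0 < INR k) by (apply lt_0_INR; lia). assert (INR k < INR M) by (apply lt_INR; lia).
    split; [apply Rdiv_lt_0_compat; lra|].
    apply Rmult_lt_reg_r with (INR M); [lra|]. unfold Rdiv. rewrite Rmult_assoc, Rinv_l; lra. }
  replace (INR k * (2 * PI / INR M)) with (2 * (INR k / INR M * PI)) in E
    by (field; apply not_0_INR; lia).
  rewrite cos_2a_sin in E. pose proof PI_RGT_0.
  pose proof (sin_gt_0 (INR k / INR M * PI) ltac:(nra) ltac:(nra)). nra.
Qed.

(** Mean over equidistant points of a circle: exact on monomials of low degree, it
    serves as a finite substitute for the integral over the circle. *)
Definition circle_mean (m : nat) (r : R) (phi : C -> C) : C :=
  (RtoC (/ INR (S m)) * Csum (fun i => phi (RtoC r * unity_root (S m) ^ i)) m)%C.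

Lemma circle_mean_monomial (m j k : nat) (r : R) : (j <= m)%nat -> (k <= m)%nat ->
  circle_mean m r (fun z => z ^ j * Cconj z ^ k)%C =
  if Nat.eqb j k then RtoC (r ^ (2 * k)) else RtoC 0.
Proof.
  intros Hj Hk. set (w := (unity_root (S m) ^ j * Cconj (unity_root (S m)) ^ k)%C).
  assert (N : RtoC (INR (S m)) <> RtoC 0).
  { intros E. apply RtoC_inj in E. revert E. apply not_0_INR. lia. }
  assert (Cj : forall n, (unity_root (S m) ^ n * Cconj (unity_root (S m)) ^ n = RtoC 1)%C).
  { intros n. now rewrite <- Cpow_mult_l, unity_root_conj, Cpow_1_l. }
  assert (E : circle_mean m r (fun z => z ^ j * Cconj z ^ k)%C =
     (RtoC (/ INR (S m)) * (RtoC (r ^ (j + k)) * Csum (fun i => w ^ i) m))%C).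
  { unfold circle_mean. f_equal. rewrite <- Csum_mult_l. apply Csum_ext. intros i _.
    rewrite Cmult_conj, Cpow_conj. replace (Cconj (RtoC r)) with (RtoC r).
    2:{ unfold Cconj, RtoC; simpl. f_equal; ring. }
    unfold w. rewrite !Cpow_mult_l, RtoC_pow, Cpow_add_r, <- !Cpow_mult_r.
    rewrite (Nat.mul_comm i j), (Nat.mul_comm i k). ring. }
  rewrite E. destruct (Nat.eqb_spec j k) as [->|Hjk].
  - rewrite (Csum_ext _ (fun _ => RtoC 1)).
    2:{ intros i _. unfold w. now rewrite Cj, Cpow_1_l. }
    rewrite Csum_const, RtoC_inv by (apply not_0_INR; lia).
    replace (k + k)%nat with (2 * k)%nat by lia. field. exact N.
  - assert (W1 : w <> RtoC 1).
    { intros W. assert (R1 : (unity_root (S m) ^ j = unity_root (S m) ^ k)%C).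
      { replace (unity_root (S m) ^ j)%C with (unity_root (S m) ^ j * (unity_root (S m) ^ k * Cconj (unity_root (S m)) ^ k))%C
          by (rewrite Cj; ring).
        replace (unity_root (S m) ^ j * (unity_root (S m) ^ k * Cconj (unity_root (S m)) ^ k))%C
          with (unity_root (S m) ^ k * w)%C by (unfold w; ring). rewrite W. ring. }
      assert (Dist : forall a b, (a < b)%nat -> (b <= m)%nat ->
        (unity_root (S m) ^ a <> unity_root (S m) ^ b)%C).
      { intros a b Hab Hb Eab. apply (unity_root_primitive (S m) (b - a)); [lia|].
        replace b with (a + (b - a))%nat in Eab by lia. rewrite Cpow_add_r in Eab.
        replace (unity_root (S m) ^ (b - a))%C
          with (unity_root (S m) ^ a * Cconj (unity_root (S m)) ^ a * unity_root (S m) ^ (b - a))%C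
          by (rewrite Cj; ring).
        replace (unity_root (S m) ^ a * Cconj (unity_root (S m)) ^ a * unity_root (S m) ^ (b - a))%C
          with (unity_root (S m) ^ a * unity_root (S m) ^ (b - a) * Cconj (unity_root (S m)) ^ a)%C by ring.
        rewrite <- Eab. apply Cj. }
      destruct (Nat.lt_total j k) as [L|[L|L]]; [|contradiction|].
      - exact (Dist j k L Hk R1).
      - exact (Dist k j L Hj (eq_sym R1)). }
    assert (Wm : (w ^ S m = RtoC 1)%C).
    { unfold w. rewrite Cpow_mult_l, <- !Cpow_mult_r, (Nat.mul_comm j), (Nat.mul_comm k).
      rewrite !Cpow_mult_r, <- Cpow_conj, unity_root_order by lia.
      replace (Cconj (RtoC 1)) with (RtoC 1) by (unfold Cconj, RtoC; simpl; f_equal; ring).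
      rewrite !Cpow_1_l. ring. }
    pose proof (geometric_Csum w m) as Gm. rewrite Wm in Gm.
    assert (Z : Csum (fun i => w ^ i)%C m = RtoC 0 :> C).
    { assert (Nz : (w - RtoC 1 <> RtoC 0)%C) by (apply Cminus_eq_contra; exact W1).
      replace (Csum (fun i => w ^ i)%C m)
        with ((w - RtoC 1) * Csum (fun i => w ^ i)%C m / (w - RtoC 1))%C by (field; exact Nz).
      rewrite Gm. field. exact Nz. }
    rewrite Z. ring.
Qed.

(** Parseval for polynomials, the degrees staying below the number of nodes. *)
Lemma circle_mean_poly (c x : nat -> C) (n m : nat) (r : R) : (n <= m)%nat ->
  circle_mean m r (fun z => Csum (fun j => c j * z ^ j) m * Cconj (Csum (fun k => x k * z ^ k) n))%C
  = Csum (fun k => c k * Cconj (x k) * RtoC (r ^ (2 * k)))%C n.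
Proof.
  intros Hn.
  transitivity (Csum (fun k => Csum (fun j => c j * Cconj (x k) *
     circle_mean m r (fun z => z ^ j * Cconj z ^ k)) m) n)%C.
  - unfold circle_mean.
    rewrite (Csum_ext _ (fun i => Csum (fun k => Csum (fun j => c j * Cconj (x k) *
       ((RtoC r * unity_root (S m) ^ i) ^ j * Cconj (RtoC r * unity_root (S m) ^ i) ^ k)) m) n)%C).
    2:{ intros i _. set (z := (RtoC r * unity_root (S m) ^ i)%C).
        rewrite Cconj_Csum, <- Csum_mult_l. apply Csum_ext. intros k _.
        rewrite Cmult_comm, <- Csum_mult_l. apply Csum_ext. intros j _.
        rewrite Cmult_conj, Cpow_conj. ring. }
    rewrite Csum_switch, <- Csum_mult_l. apply Csum_ext. intros k _.
    rewrite Csum_switch, <- Csum_mult_l. apply Csum_ext. intros j _.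
    rewrite Csum_mult_l. ring.
  - apply Csum_ext. intros k Hk. rewrite (Csum_single _ k) by
      (try lia; intros j Hj Hjk; rewrite circle_mean_monomial by lia;
       rewrite (proj2 (Nat.eqb_neq j k) Hjk); ring).
    rewrite circle_mean_monomial by lia. rewrite Nat.eqb_refl. reflexivity.
Qed.

Lemma continuous_ge0_at_1 (g : R -> R) :
  continuity_pt g 1 -> (forall r, 0 < r < 1 -> 0 <= g r) -> 0 <= g 1.
Proof.
  intros Hc Hg. destruct (Rle_lt_dec 0 (g 1)) as [|Hn]; [assumption|exfalso].
  destruct (Hc (- g 1) ltac:(lra)) as [d [Hd K]].
  pose (r := 1 - Rmin (d / 2) (1 / 2)).
  assert (Hr : 0 < 1 - r <= 1 / 2 /\ 1 - r < d).
  { unfold r. pose proof (Rmin_l (d / 2) (1 / 2)). pose proof (Rmin_r (d / 2) (1 / 2)).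
    assert (0 < Rmin (d / 2) (1 / 2)) by (apply Rmin_pos; lra). lra. }
  specialize (K r). specialize (Hg r ltac:(lra)).
  assert (D : Rabs (g r - g 1) < - g 1).
  { apply K. split; [split; [exact I|lra]|]. simpl. unfold R_dist.
    rewrite Rabs_left by lra. lra. }
  apply Rabs_def2 in D. lra.
Qed.

(** The mean over |z| = r of f conj(X) is the sum of c_k conj(x_k) r^(2k), and the
    real part of a mean of values with nonnegative real part is nonnegative; then r
    tends to 1. For f = P X with Re P >= 0 this is the positivity of the Toeplitz
    forms of P. *)
Lemma coefficient_positivity (c : nat -> C) (f : C -> C) (x : nat -> C) (n : nat) :
  has_PS c f ->
  (forall z, in_disk z -> 0 <= Re (f z * Cconj (Csum (fun k => x k * z ^ k) n))%C) ->
  0 <= Re (Csum (fun k => c k * Cconj (x k)) n)%C.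
Proof.
  intros Hf Hpos.
  assert (Hr : forall r, 0 < r < 1 ->
    0 <= sum_n (fun k => Re (c k * Cconj (x k))%C * r ^ (2 * k)) n).
  { intros r Hr.
    set (T := sum_n (fun k => Re (c k * Cconj (x k))%C * r ^ (2 * k)) n).
    set (B := sum_n (fun k => Cmod (x k)) n).
    assert (PB : 0 <= B).
    { unfold B. rewrite sum_n_Reals. apply cond_pos_sum. intros; apply Cmod_ge_0. }
    destruct (Rle_lt_dec 0 T) as [|Hneg]; [assumption|exfalso].
    pose (eps := - T / (2 * (B + 1))).
    assert (Pe : 0 < eps) by (apply Rdiv_lt_0_compat; lra).
    (* Were T negative, nodes taken finer than the degree of an eps-accurate
       partial sum would contradict the positivity of the mean. *)
    destruct (has_PS_tail c f r eps Hf ltac:(lra) Pe) as [N0 HN].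
    pose (m := Nat.max N0 n).
    pose proof (circle_mean_poly c x n m r ltac:(unfold m; lia)) as Em.
    apply (f_equal Re) in Em. rewrite Re_Csum in Em.
    assert (ET : T = Re (circle_mean m r (fun z => Csum (fun j => c j * z ^ j) m *
                       Cconj (Csum (fun k => x k * z ^ k) n))%C)).
    { rewrite Em. unfold T. apply sum_n_ext. intros k. now rewrite re_scal_r. }
    unfold circle_mean in ET. rewrite re_scal_l, Re_Csum in ET.
    assert (PM : 0 < INR (S m)) by (apply lt_0_INR; lia).
    assert (Low : - (eps * B) <= T).
    { rewrite ET. apply Rmult_le_reg_l with (INR (S m)); [exact PM|].
      rewrite <- Rmult_assoc, Rinv_r, Rmult_1_l by lra.
      rewrite <- sum_n_const, !sum_n_Reals. apply sum_Rle. intros i _.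
      set (z := (RtoC r * unity_root (S m) ^ i)%C).
      assert (Mz : Cmod z = r).
      { unfold z. rewrite Cmod_mult, Cmod_R, Cmod_pow, Rabs_pos_eq by lra.
        assert (M1 : Cmod (unity_root (S m)) = 1).
        { unfold Cmod, unity_root; simpl. rewrite !Rmult_1_r, <- sqrt_1. f_equal.
          rewrite Rplus_comm. apply sin2_cos2. }
        rewrite M1, pow1. ring. }
      set (X := Csum (fun k => x k * z ^ k)%C n).
      assert (BX : Cmod (Cconj X) <= B).
      { rewrite Cmod_conj. apply Cmod_Csum_le. intros k.
        rewrite Cmod_mult, Cmod_pow, Mz. pose proof (Cmod_ge_0 (x k)).
        assert (r ^ k <= 1) by (rewrite <- (pow1 k); apply pow_incr; lra). nra. }
      specialize (Hpos z ltac:(unfold in_disk; lra)). fold X in Hpos.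
      specialize (HN m ltac:(unfold m; lia) z Mz).
      replace (Csum (fun j => c j * z ^ j) m * Cconj X)%C
        with (f z * Cconj X - (f z - Csum (fun j => c j * z ^ j) m) * Cconj X)%C by ring.
      set (E := ((f z - Csum (fun j => c j * z ^ j) m) * Cconj X)%C).
      assert (BE : Re E <= eps * B).
      { eapply Rle_trans; [apply Rle_abs|]. eapply Rle_trans; [apply Rabs_Re_le|].
        unfold E. rewrite Cmod_mult. apply Rmult_le_compat; try apply Cmod_ge_0; assumption. }
      change (- (eps * B) <= Re (f z * Cconj X)%C - Re E). lra. }
    assert (Eb : eps * (B + 1) = - T / 2) by (unfold eps; field; lra).
    nra. }
  rewrite Re_Csum.
  set (g := fun r => sum_n (fun k => Re (c k * Cconj (x k))%C * r ^ (2 * k)) n).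
  replace (sum_n (fun k => Re (c k * Cconj (x k))%C) n) with (g 1).
  2:{ unfold g. apply sum_n_ext. intros k. rewrite pow1. apply Rmult_1_r. }
  apply continuous_ge0_at_1; [|exact Hr].
  unfold g. clear. induction n as [|n IH].
  - apply continuity_pt_ext with (fun r => Re (c 0%nat * Cconj (x 0%nat))%C * r ^ (2 * 0)).
    { intros r. now rewrite sum_O. }
    reg.
  - apply continuity_pt_ext with
      (fun r => sum_n (fun k => Re (c k * Cconj (x k))%C * r ^ (2 * k)) n +
                Re (c (S n) * Cconj (x (S n)))%C * r ^ (2 * S n)).
    { intros r. now rewrite sum_Sn. }
    apply (continuity_pt_plus _ (fun r => Re (c (S n) * Cconj (x (S n)))%C * r ^ (2 * S n))
      1 IH). reg.
Qed.

Lemma Re_mult_conj_self (a z : C) : Re (a * z * Cconj z)%C = Re a * Cmod z ^ 2.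
Proof.
  rewrite <- Cmult_assoc, <- Cmod2_conj. apply re_scal_r.
Qed.

(** In terms of the Schwarz function w = (P - 1) / (P + 1) = c1 z + c2 z^2 + ...
    this is |c2| <= 1 - |c1|^2. *)
Lemma caratheodory_second (p : nat -> C) (P : C -> C) :
  has_PS p P -> p 0%nat = RtoC 1 -> (forall z, in_disk z -> 0 <= Re (P z)) ->
  Cmod (p 2%nat - p 1%nat * p 1%nat / RtoC 2)%C <= 2 - Cmod (p 1%nat) ^ 2 / 2.
Proof.
  intros HP p0 Hpos. apply Cmod_le_of_rotations. intros u Hu.
  (* For X = 1 + x1 z + x2 z^2 with |x2| = 1 the positive quantity is a quadratic
     polynomial in x1, minimal at the x1 below, and x2 is chosen so that the term
     p 2 - (p 1)^2 / 2 enters it as -u (p 2 - (p 1)^2 / 2). *)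
  pose (x2 := (- Cconj u)%C).
  pose (x1 := (- ((p 1%nat + Cconj (p 1%nat) * x2) / RtoC 2))%C).
  pose (x := fun n => match n with O => RtoC 1 | 1%nat => x1 | _ => x2 end).
  pose proof (coefficient_positivity _ _ x 2 (has_PS_mult _ _ _ _ HP (has_PS_poly x 2))) as K.
  cbv beta in K.
  assert (K1 : 0 <= Re (Csum (fun k => conv p (fun n => if Nat.leb n 2 then x n else RtoC 0) k * Cconj (x k)) 2)%C).
  { apply K. intros z Hz. rewrite Re_mult_conj_self.
    apply Rmult_le_pos; [now apply Hpos|apply pow2_ge_0]. }
  clear K. unfold conv in K1. rewrite !Csum_S, !Csum_0 in K1. simpl in K1.
  rewrite p0 in K1. unfold x1, x2 in K1. clear x x1 x2.
  rewrite Cmod2_alt. assert (Hu2 : Cmod u ^ 2 = 1) by (rewrite Hu; ring).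
  rewrite Cmod2_alt in Hu2.
  destruct (p 1%nat) as [a b], (p 2%nat) as [c d], u as [s t].
  unfold Cdiv, Cminus in *. rewrite <- RtoC_inv in * by lra.
  unfold Cplus, Cmult, Copp, Cconj, RtoC in *. simpl in *.
  assert (E : (s * s + t * t - 1) * (1 - (a * a + b * b) / 4) = 0) by (replace (s * s + t * t) with 1 by lra; ring).
  lra.
Qed.

(** The reciprocal of a function with positive real part has positive real part,
    which bounds the coefficients of its formal reciprocal by 2; the formal
    reciprocal therefore converges in the whole disk. *)
Lemma reciprocal_PS (g : nat -> C) (G : C -> C) :
  has_PS g G -> g 0%nat = RtoC 1 -> (forall z, in_disk z -> 0 <= Re (G z)) ->
  exists h, h 0%nat = RtoC 1 /\ h 1%nat = (- g 1%nat)%C /\ has_PS h (power_sum h) /\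
    forall z, in_disk z -> (G z * power_sum h z)%C = RtoC 1.
Proof.
  intros HG g0 Hpos.
  destruct (recursion_exists (fun n a => match n with
     | O => RtoC 1
     | S m => (- Csum (fun k => g (S k) * a (m - k)%nat) m)%C end)) as [h Hh].
  { intros [|m] a b Hab; [reflexivity|]. f_equal. apply Csum_ext. intros k Hk.
    rewrite Hab by lia. reflexivity. }
  assert (h0 : h 0%nat = RtoC 1) by apply Hh.
  assert (Inv : forall m, conv g h (S m) = RtoC 0).
  { intros m. rewrite conv_S, g0, (Hh (S m)). ring. }
  assert (Bd : forall n, Cmod (h n) <= 2).
  { intros [|m]; [rewrite h0, Cmod_1; lra|].
    (* With X the truncation of h at order n, its last coefficient halved, G X is
       1 - (h n / 2) z^n up to higher order terms, and positivity reads
       0 <= 1 - |h n|^2 / 4. *)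
    pose (x := fun n => if Nat.eqb n (S m) then (h n / RtoC 2)%C else h n).
    assert (xh : forall k, (k <= m)%nat -> x k = h k).
    { intros k Hk. unfold x. rewrite (proj2 (Nat.eqb_neq k (S m))) by lia. reflexivity. }
    pose proof (coefficient_positivity _ _ x (S m) (has_PS_mult _ _ _ _ HG (has_PS_poly x (S m)))) as K.
    cbv beta in K. set (xt := fun n => if Nat.leb n (S m) then x n else RtoC 0) in K.
    assert (xtx : forall k, (k <= S m)%nat -> xt k = x k).
    { intros k Hk. unfold xt. rewrite (proj2 (Nat.leb_le k (S m)) Hk). reflexivity. }
    assert (K1 : 0 <= Re (Csum (fun k => conv g xt k * Cconj (x k)) (S m))%C).
    { apply K. intros z Hz. rewrite Re_mult_conj_self.
      apply Rmult_le_pos; [now apply Hpos|apply pow2_ge_0]. }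
    clear K. rewrite Csum_S in K1.
    assert (N2 : RtoC 2 <> RtoC 0) by (apply RtoC_neq_0; lra).
    assert (E1 : Csum (fun k => conv g xt k * Cconj (x k))%C m = RtoC 1 :> C).
    { rewrite (Csum_single _ 0); [|lia|].
      2:{ intros [|j] Hj Hj0; [contradiction|].
          rewrite (conv_ext g xt h) by (intros k Hk; rewrite xtx, xh by lia; reflexivity).
          rewrite Inv. ring. }
      rewrite conv_0, xtx, xh, h0, g0 by lia. unfold Cconj, RtoC, Cmult; simpl. f_equal; ring. }
    assert (E2 : conv g xt (S m) = (- (h (S m) / RtoC 2))%C).
    { rewrite conv_S, g0, xtx by lia.
      rewrite (Csum_ext _ (fun k => g (S k) * h (m - k)%nat)%C)
        by (intros k Hk; rewrite xtx, xh by lia; reflexivity).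
      replace (Csum (fun k => g (S k) * h (m - k)%nat)%C m) with (- h (S m))%C
        by (rewrite (Hh (S m)); ring).
      unfold x. rewrite Nat.eqb_refl. field. }
    rewrite E1, E2 in K1. unfold x in K1. rewrite Nat.eqb_refl in K1.
    pose proof (Re_mult_conj_self (RtoC 1) (h (S m) / RtoC 2)%C) as M.
    rewrite Cmult_1_l, Cmod_div, Cmod_R, (Rabs_pos_eq 2) in M by (exact N2 || lra).
    replace (RtoC 1 + - (h (S m) / RtoC 2) * Cconj (h (S m) / RtoC 2))%C
      with (RtoC 1 - h (S m) / RtoC 2 * Cconj (h (S m) / RtoC 2))%C in K1 by ring.
    change (0 <= 1 - Re (h (S m) / RtoC 2 * Cconj (h (S m) / RtoC 2))%C) in K1.
    rewrite M in K1. change (Re (RtoC 1)) with 1 in K1.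
    pose proof (Cmod_ge_0 (h (S m))). nra. }
  assert (Sh : subexp h).
  { intros q Hq. exists 2. intros n. pose proof (Cmod_ge_0 (h n)).
    assert (0 <= q ^ n) by (apply pow_le; lra).
    assert (q ^ n <= 1) by (rewrite <- (pow1 n); apply pow_incr; lra).
    specialize (Bd n). nra. }
  exists h. split; [exact h0|]. split; [|split; [now apply has_PS_power_sum|]].
  { rewrite (Hh 1%nat), Csum_0. simpl. rewrite h0. ring. }
  intros z Hz.
  refine (is_Cseries_unique _ _ _ (has_PS_mult _ _ _ _ HG (has_PS_power_sum h Sh) z Hz) _).
  pose proof (has_PS_poly (fun _ => RtoC 1) 0 z Hz) as P1. cbv beta in P1.
  rewrite Csum_0 in P1. simpl in P1. rewrite Cmult_1_l in P1.
  eapply is_Cseries_ext with (2 := P1). intros [|n]; simpl.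
  - rewrite conv_0, g0, h0. ring.
  - rewrite Inv. ring.
Qed.

(** * Bazilevic functions and functions with positive real part *)

(** Coefficients of G + z G' / alpha, which for G = (f(z)/z)^alpha is
    (f(z)/z)^(alpha-1) f'(z). *)
Definition euler_coef (alpha : R) (g : nat -> C) (n : nat) : C :=
  (g n + RtoC (/ alpha) * match n with O => RtoC 0 | S m => derive_coef g m end)%C.

Lemma has_PS_euler (alpha : R) (g : nat -> C) (G : C -> C) :
  has_PS g G ->
  has_PS (euler_coef alpha g) (fun z => G z + RtoC (/ alpha) * (z * power_sum (derive_coef g) z))%C.
Proof.
  intros HG. unfold euler_coef.
  exact (has_PS_plus _ _ _ _ HG (has_PS_scal _ _ _ (has_PS_mult_id _ _ (has_PS_derive_coef g G HG)))).
Qed.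

(** On a ray, s^alpha Re G(s z) has derivative alpha s^(alpha-1) Re (G + z G' /
    alpha), hence increases, and it is positive near the origin. *)
Lemma Re_pos_from_euler (alpha : R) (g : nat -> C) (G : C -> C) :
  0 < alpha -> has_PS g G -> g 0%nat = RtoC 1 ->
  (forall z, in_disk z -> 0 < Re (G z + RtoC (/ alpha) * (z * power_sum (derive_coef g) z))%C) ->
  forall z, in_disk z -> 0 < Re (G z).
Proof.
  intros Ha HG g0 Hpos z Hz.
  assert (D : forall t, 0 <= t <= 1 -> in_disk (RtoC t * z)%C).
  { intros t Ht. unfold in_disk in *. rewrite Cmod_mult, Cmod_R, Rabs_pos_eq by lra.
    pose proof (Cmod_ge_0 z). nra. }
  (* On the ray through z, alpha u + s u' is alpha times the real part assumed positive. *)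
  pose (u := fun s => Re (G (RtoC s * z)%C)).
  pose (du := fun s => Re (power_sum (derive_coef g) (RtoC s * z) * z)%C).
  assert (Du : forall s, 0 <= s <= 1 -> is_derive u s (du s)).
  { intros s Hs. exact (proj1 (is_derive_ray G z _ s (has_PS_derive g G _ HG (D s Hs)))). }
  assert (u0 : u 0 = 1).
  { unfold u. rewrite Cmult_0_l, (has_PS_at_0 g G HG), g0. reflexivity. }
  assert (Ineq : forall s, 0 <= s <= 1 -> 0 < alpha * u s + s * du s).
  { intros s Hs. specialize (Hpos _ (D s Hs)).
    apply Rmult_lt_compat_l with (r := alpha) in Hpos; [|exact Ha].
    replace (alpha * u s + s * du s) with
      (alpha * Re (G (RtoC s * z) + RtoC (/ alpha) * (RtoC s * z * power_sum (derive_coef g) (RtoC s * z)))%C);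
      [lra|].
    unfold u, du. rewrite re_plus, re_scal_l.
    replace (RtoC s * z * power_sum (derive_coef g) (RtoC s * z))%C
      with (RtoC s * (power_sum (derive_coef g) (RtoC s * z) * z))%C by ring.
    rewrite re_scal_l. field. lra. }
  (* Re G is near 1 close to the origin: a starting point s0 with u s0 > 0. *)
  destruct (Rderive_eps u 0 (du 0) (Du 0 ltac:(lra)) 1 ltac:(lra)) as [d [Pd Hd]].
  set (m := Rabs (du 0) + 1). assert (Pm : 0 < m) by (unfold m; pose proof (Rabs_pos (du 0)); lra).
  pose (s0 := Rmin (d / 2) (Rmin (1 / 2) (1 / (2 * m)))).
  assert (Ps0 : 0 < s0).
  { apply Rmin_pos; [lra|]. apply Rmin_pos; [lra|]. apply Rdiv_lt_0_compat; lra. }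
  assert (Bs0 : s0 <= d / 2 /\ s0 <= 1 / 2 /\ s0 <= 1 / (2 * m)).
  { unfold s0. pose proof (Rmin_l (d / 2) (Rmin (1 / 2) (1 / (2 * m)))).
    pose proof (Rmin_r (d / 2) (Rmin (1 / 2) (1 / (2 * m)))).
    pose proof (Rmin_l (1 / 2) (1 / (2 * m))). pose proof (Rmin_r (1 / 2) (1 / (2 * m))). lra. }
  assert (us0 : 0 < u s0).
  { specialize (Hd s0 ltac:(rewrite Rabs_pos_eq; lra)).
    rewrite Rplus_0_l, u0, (Rabs_pos_eq s0) in Hd by lra.
    assert (B : Rabs (du 0 * s0) <= Rabs (du 0) * s0) by (rewrite Rabs_mult, (Rabs_pos_eq s0); lra).
    pose proof (Rle_abs (- (u s0 - 1 - du 0 * s0))) as B1. rewrite Rabs_Ropp in B1.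
    pose proof (Rle_abs (- (du 0 * s0))) as B2. rewrite Rabs_Ropp in B2.
    assert (m * s0 <= 1 / 2).
    { replace (1 / 2) with (m * (1 / (2 * m))) by (field; lra). apply Rmult_le_compat_l; lra. }
    unfold m in *. lra. }
  pose (phi := fun s => Rpower s alpha * u s).
  assert (Dphi : forall s, s0 <= s <= 1 ->
    is_derive phi s (Rpower s (alpha - 1) * (alpha * u s + s * du s))).
  { intros s Hs.
    assert (DR : is_derive (fun s => Rpower s alpha) s (alpha * Rpower s (alpha - 1))).
    { apply is_derive_Reals, derivable_pt_lim_power. lra. }
    pose proof (is_derive_mult (K := R_AbsRing) _ u s _ _ DR (Du s ltac:(lra)) Rmult_comm) as K.
    replace (Rpower s (alpha - 1) * (alpha * u s + s * du s))
      with (plus (mult (alpha * Rpower s (alpha - 1)) (u s)) (mult (Rpower s alpha) (du s))); [exact K|].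
    assert (E : Rpower s alpha = s * Rpower s (alpha - 1)).
    { rewrite <- (Rpower_1 s) at 2 by lra. rewrite <- Rpower_plus. f_equal. ring. }
    rewrite E. unfold plus, mult; simpl. ring. }
  assert (Inc : phi s0 <= phi 1).
  { destruct (MVT_gen phi s0 1 (fun s => Rpower s (alpha - 1) * (alpha * u s + s * du s)))
      as [c [Hc Ec]].
    - rewrite Rmin_left, Rmax_right by lra. intros s Hs. apply Dphi. lra.
    - rewrite Rmin_left, Rmax_right by lra. intros s Hs.
      apply derivable_continuous_pt. eexists. apply is_derive_Reals, Dphi, Hs.
    - rewrite Rmin_left, Rmax_right in Hc by lra.
      assert (0 < Rpower c (alpha - 1)) by apply exp_pos.
      pose proof (Ineq c ltac:(lra)).
      assert (0 <= Rpower c (alpha - 1) * (alpha * u c + c * du c) * (1 - s0))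
        by (repeat apply Rmult_le_pos; lra). lra. }
  assert (0 < phi s0) by (apply Rmult_lt_0_compat; [apply exp_pos|exact us0]).
  assert (E1 : phi 1 = Re (G z)).
  { unfold phi, u, Rpower. rewrite ln_1, Rmult_0_r, exp_0, Cmult_1_l. ring. }
  lra.
Qed.

Lemma eq_id_mult_Cexp_log (f L : C -> C) :
  f (RtoC 0) = RtoC 0 -> is_log_branch (quot_id f) L ->
  forall z, in_disk z -> f z = (z * Cexp (L z))%C.
Proof.
  intros f0 [_ [_ E]] z Hz. rewrite E by exact Hz. unfold quot_id.
  destruct (Ceq_dec z (RtoC 0)) as [->|N]; [rewrite f0; ring|field; exact N].
Qed.

Lemma bazilevic_expression (alpha : R) (f L : C -> C) (z dL : C) :
  (forall w, in_disk w -> f w = (w * Cexp (L w))%C) -> in_disk z ->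
  is_Cderive L z dL ->
  is_Cderive f z (Cexp (L z) * (RtoC 1 + z * dL))%C /\
  (Cexp (RtoC (alpha - 1) * L z) * C_derive f z
    = Cexp (RtoC alpha * L z) * (RtoC 1 + z * dL))%C.
Proof.
  intros Ef Hz HL.
  assert (D : is_Cderive f z (Cexp (L z) * (RtoC 1 + z * dL))%C).
  { apply (is_Cderive_ext_disk (fun w => w * Cexp (L w))%C); [|exact Hz|].
    { intros w Hw. symmetry. now apply Ef. }
    replace (Cexp (L z) * (RtoC 1 + z * dL))%C
      with (RtoC 1 * Cexp (L z) + z * (dL * Cexp (L z)))%C by ring.
    exact (is_Cderive_mult (fun w => w) _ z _ _ (is_Cderive_id z)
      (is_Cderive_comp Cexp L z _ _ (is_Cderive_Cexp _) HL)). }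
  split; [exact D|]. rewrite (is_C_derive_unique f z _ D).
  rewrite Cmult_assoc, <- Cexp_plus. f_equal. f_equal. rewrite RtoC_minus. ring.
Qed.

(** With G = exp(alpha L) the defining expression of the class is P = G + z G' /
    alpha, so the coefficients of P are explicit in those of L. *)
Lemma B1_caratheodory_coefs (alpha : R) (f : C -> C) (gamma : nat -> C) :
  0 < alpha -> class_B1 alpha f -> log_coefficients f gamma ->
  exists p P, has_PS p P /\ p 0%nat = RtoC 1 /\ (forall z, in_disk z -> 0 < Re (P z)) /\
    p 1%nat = (RtoC (2 * (alpha + 1)) * gamma 1%nat)%C /\
    p 2%nat = (RtoC (alpha + 2) * (RtoC 2 * gamma 2%nat +
                 RtoC (2 * alpha) * (gamma 1%nat * gamma 1%nat)))%C.
Proof.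
  intros Ha [[_ [f0 _]] [_ [L0 [HL0 Hpos]]]] [L [HL Hser]].
  pose (l := fun n => match n with O => RtoC 0 | S m => (RtoC 2 * gamma (S m))%C end).
  assert (PL : has_PS l L).
  { intros z Hz. apply is_Cseries_shift; [simpl; ring|].
    eapply is_Cseries_ext with (2 := Hser z Hz). intros n. simpl. ring. }
  pose proof (has_PS_scal _ _ (RtoC alpha) PL) as PaL. cbv beta in PaL.
  destruct (has_PS_Cexp _ _ PaL) as [g [g0 [Rec PG]]]; [simpl; ring|].
  exists (euler_coef alpha g). eexists. split; [apply has_PS_euler; exact PG|].
  assert (E1 : g 1%nat = (RtoC (2 * alpha) * gamma 1%nat)%C).
  { pose proof (Rec 0%nat) as R0. rewrite conv_0, g0 in R0. unfold derive_coef, l in R0. simpl in R0.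
    rewrite RtoC_mult. rewrite Cmult_1_l in R0. rewrite R0. ring. }
  assert (E2 : g 2%nat = (RtoC (2 * alpha) * gamma 2%nat +
                          RtoC (2 * alpha * alpha) * (gamma 1%nat * gamma 1%nat))%C).
  { pose proof (Rec 1%nat) as R1. rewrite conv_1, g0, E1 in R1. unfold derive_coef, l in R1. simpl in R1.
    rewrite !RtoC_plus, !RtoC_mult in *.
    assert (N2 : RtoC 2 <> RtoC 0) by (apply RtoC_neq_0; lra).
    replace (g 2%nat) with ((RtoC 1 + RtoC 1) * g 2%nat / RtoC 2)%C
      by (rewrite <- RtoC_plus; replace (1 + 1) with 2 by ring; field; exact N2).
    rewrite R1, <- RtoC_plus. replace (1 + 1) with 2 by ring. field. }
  assert (Na : RtoC alpha <> RtoC 0) by (apply RtoC_neq_0; lra).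
  split; [|split; [|split]].
  - unfold euler_coef. rewrite g0. ring.
  - intros z Hz.
    pose proof (has_PS_derive l L z PL Hz) as DL. set (dL := power_sum (derive_coef l) z) in *.
    pose proof (has_PS_derive g _ z PG Hz) as DG1.
    pose proof (is_Cderive_comp Cexp (fun w => RtoC alpha * L w)%C z _ _
                  (is_Cderive_Cexp _) (is_Cderive_scal L (RtoC alpha) z _ DL)) as DG2.
    rewrite (is_Cderive_unique _ _ _ _ DG1 DG2).
    destruct (bazilevic_expression alpha f L z dL (eq_id_mult_Cexp_log f L f0 HL) Hz DL) as [_ B].
    specialize (Hpos z Hz). rewrite <- (log_branch_unique _ _ _ HL HL0 z Hz), B in Hpos.
    replace (Cexp (RtoC alpha * L z) +
       RtoC (/ alpha) * (z * (RtoC alpha * dL * Cexp (RtoC alpha * L z))))%C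
      with (Cexp (RtoC alpha * L z) * (RtoC 1 + z * dL))%C; [exact Hpos|].
    rewrite RtoC_inv by lra. field. exact Na.
  - unfold euler_coef, derive_coef. simpl. rewrite E1, RtoC_inv by lra.
    rewrite !RtoC_mult, !RtoC_plus. field. exact Na.
  - unfold euler_coef, derive_coef. simpl. rewrite E2, RtoC_inv by lra.
    rewrite !RtoC_mult, !RtoC_plus. replace 2 with (1 + 1) by ring. rewrite !RtoC_plus.
    field. exact Na.
Qed.

(** Converse construction: solve P = G + z G' / alpha coefficientwise, then take f =
    z exp(L) with alpha L = log G. The logarithm is obtained as a power series
    converging in the disk because Re G > 0 gives 1 / G such a series. *)
Lemma B1_of_caratheodory (alpha : R) (p : nat -> C) (P : C -> C) :
  0 < alpha -> has_PS p P -> p 0%nat = RtoC 1 -> (forall z, in_disk z -> 0 < Re (P z)) ->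
  exists f gamma, class_B1 alpha f /\ log_coefficients f gamma /\
    p 1%nat = (RtoC (2 * (alpha + 1)) * gamma 1%nat)%C /\
    p 2%nat = (RtoC (alpha + 2) * (RtoC 2 * gamma 2%nat +
                 RtoC (2 * alpha) * (gamma 1%nat * gamma 1%nat)))%C.
Proof.
  intros Ha HP p0 Hpos.
  assert (Na : RtoC alpha <> RtoC 0) by (apply RtoC_neq_0; lra).
  pose (g := fun n => (RtoC (alpha / (alpha + INR n)) * p n)%C).
  assert (g0 : g 0%nat = RtoC 1).
  { unfold g. simpl. rewrite p0, Rplus_0_r. replace (alpha / alpha) with 1 by (field; lra). ring. }
  assert (Eg : forall n, euler_coef alpha g n = p n).
  { intros n. unfold euler_coef.
    assert (E : (match n with O => RtoC 0 | S m => derive_coef g m end = RtoC (INR n) * g n)%C).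
    { destruct n; [simpl; ring|reflexivity]. }
    rewrite E. unfold g. pose proof (pos_INR n).
    replace (RtoC (alpha / (alpha + INR n)) * p n + RtoC (/ alpha) * (RtoC (INR n) * (RtoC (alpha / (alpha + INR n)) * p n)))%C
      with (RtoC (alpha / (alpha + INR n) + / alpha * (INR n * (alpha / (alpha + INR n)))) * p n)%C
      by (rewrite RtoC_plus, !RtoC_mult; ring).
    replace (alpha / (alpha + INR n) + / alpha * (INR n * (alpha / (alpha + INR n)))) with 1 by (field; lra).
    ring. }
  assert (Sg : subexp g).
  { intros q Hq. destruct (has_PS_subexp p P HP q Hq) as [M HM]. exists M. intros n.
    eapply Rle_trans; [|apply (HM n)]. apply Rmult_le_compat_r; [apply pow_le; lra|].
    unfold g. rewrite Cmod_mult, Cmod_R. pose proof (pos_INR n). pose proof (Cmod_ge_0 (p n)).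
    assert (0 <= alpha / (alpha + INR n) <= 1).
    { split; [apply Rmult_le_pos; [lra|left; apply Rinv_0_lt_compat; lra]|].
      apply Rmult_le_reg_r with (alpha + INR n); [lra|].
      unfold Rdiv. rewrite Rmult_assoc, Rinv_l; lra. }
    rewrite Rabs_pos_eq by lra. nra. }
  pose proof (has_PS_power_sum g Sg) as HG. set (G := power_sum g) in *. set (dG := power_sum (derive_coef g)).
  assert (EP : forall z, in_disk z -> (G z + RtoC (/ alpha) * (z * dG z))%C = P z).
  { intros z Hz. refine (is_Cseries_unique _ _ _ (has_PS_euler alpha g G HG z Hz) _).
    eapply is_Cseries_ext with (2 := HP z Hz). intros n. simpl. now rewrite Eg. }
  assert (RG : forall z, in_disk z -> 0 < Re (G z)).
  { apply (Re_pos_from_euler alpha g G Ha HG g0). intros z Hz. fold dG. rewrite EP; auto. }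
  destruct (reciprocal_PS g G HG g0 (fun z Hz => Rlt_le _ _ (RG z Hz))) as [h [h0 [h1 [Hh Inv]]]].
  pose proof (has_PS_scal _ _ (RtoC (/ alpha)) (has_PS_mult _ _ _ _ (has_PS_derive_coef g G HG) Hh)) as HdL.
  fold dG in HdL. cbv beta in HdL.
  set (dl := fun n => (RtoC (/ alpha) * conv (derive_coef g) h n)%C) in HdL.
  (* L is the primitive of G' / (alpha G), that is of the derivative of log G / alpha. *)
  pose (l := antider_coef dl).
  pose proof (has_PS_power_sum l (subexp_antider_coef _ (has_PS_subexp _ _ HdL))) as HL. set (L := power_sum l) in *.
  assert (DL : forall z, in_disk z -> is_Cderive L z (RtoC (/ alpha) * (dG z * power_sum h z))%C).
  { intros z Hz.
    replace (RtoC (/ alpha) * (dG z * power_sum h z))%C with (power_sum (derive_coef l) z);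
      [now apply has_PS_derive|].
    refine (is_Cseries_unique _ _ _ (has_PS_derive_coef l L HL z Hz) _).
    eapply is_Cseries_ext with (2 := HdL z Hz). intros n. simpl. unfold l. now rewrite derive_coef_antider_coef. }
  assert (L0 : L (RtoC 0) = RtoC 0) by (rewrite (has_PS_at_0 l L HL); reflexivity).
  assert (ExpL : forall z, in_disk z -> Cexp (RtoC alpha * L z)%C = G z).
  { apply (ODE_exp G (fun z => RtoC alpha * L z)%C (fun z => dG z * power_sum h z)%C).
    - intros z Hz. replace (dG z * power_sum h z)%C with (RtoC alpha * (RtoC (/ alpha) * (dG z * power_sum h z)))%C
        by (rewrite RtoC_inv by lra; field; exact Na).
      now apply is_Cderive_scal, DL.
    - intros z Hz.
      replace (dG z * power_sum h z * G z)%C with (dG z * (G z * power_sum h z))%C by ring.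
      rewrite Inv, Cmult_1_r by exact Hz. now apply has_PS_derive.
    - rewrite L0. ring.
    - now rewrite (has_PS_at_0 g G HG). }
  pose (f := fun z => (z * Cexp (L z))%C).
  assert (Quot : forall z, Cexp (L z) = quot_id f z).
  { intros z. unfold quot_id, f. destruct (Ceq_dec z (RtoC 0)) as [->|N].
    - rewrite L0. apply Cexp_0.
    - field. exact N. }
  assert (Log : is_log_branch (quot_id f) L).
  { split; [|split]; [|exact L0|].
    - intros z Hz. eexists. apply DL, Hz.
    - intros z _. apply Quot. }
  assert (Baz := fun z Hz => bazilevic_expression alpha f L z _ (fun w _ => eq_refl) Hz (DL z Hz)).
  assert (D0 : in_disk (RtoC 0)) by (unfold in_disk; rewrite Cmod_0; lra).
  exists f, (fun n => l n / RtoC 2)%C.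
  assert (l1 : l 1%nat = (RtoC (/ alpha) * g 1%nat)%C).
  { unfold l, antider_coef, dl. rewrite conv_0, h0. unfold derive_coef. simpl. rewrite Rinv_1. ring. }
  assert (l2 : l 2%nat = (RtoC (/ alpha) * (g 2%nat - g 1%nat * g 1%nat / RtoC 2))%C).
  { unfold l, antider_coef, dl. rewrite conv_1, h0, h1. unfold derive_coef. simpl.
    replace (1 + 1) with 2 by ring. rewrite (RtoC_inv 2) by lra. field. }
  split; [|split; [|split]].
  - split; [|split].
    + split; [|split].
      * intros z Hz. eexists. apply (proj1 (Baz z Hz)).
      * unfold f. ring.
      * rewrite (is_C_derive_unique _ _ _ (proj1 (Baz _ D0))), L0, Cexp_0. ring.
    + intros z _. rewrite <- Quot. apply Cexp_neq_0.
    + exists L. split; [exact Log|]. intros z Hz. rewrite (proj2 (Baz z Hz)), ExpL by exact Hz.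
      replace (G z * (RtoC 1 + z * (RtoC (/ alpha) * (dG z * power_sum h z))))%C
        with (G z + RtoC (/ alpha) * (z * dG z) * (G z * power_sum h z))%C by ring.
      rewrite Inv, Cmult_1_r, EP by exact Hz. now apply Hpos.
  - exists L. split; [exact Log|]. intros z Hz.
    pose proof (HL z Hz) as S1.
    apply is_Cseries_unshift in S1; [|simpl; ring].
    eapply is_Cseries_ext with (2 := S1). intros n. simpl. field.
  - rewrite l1. rewrite <- (Eg 1%nat). unfold euler_coef, derive_coef. simpl.
    rewrite RtoC_inv by lra. rewrite !RtoC_mult, !RtoC_plus. field. assumption.
  - rewrite l1, l2. rewrite <- (Eg 2%nat). unfold euler_coef, derive_coef. simpl.
    rewrite RtoC_inv by lra. rewrite !RtoC_mult, !RtoC_plus.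
    field. assumption.
Qed.

(** * The estimates *)

(** [caratheodory_second] rewritten in logarithmic coefficients. *)
Lemma B1_coefficient_body (alpha : R) (f : C -> C) (gamma : nat -> C) :
  0 < alpha -> class_B1 alpha f -> log_coefficients f gamma ->
  Cmod (RtoC (alpha + 2) * gamma 2%nat - gamma 1%nat * gamma 1%nat)%C
    <= 1 - (alpha + 1) ^ 2 * Cmod (gamma 1%nat) ^ 2.
Proof.
  intros Ha Hf Hg.
  destruct (B1_caratheodory_coefs alpha f gamma Ha Hf Hg) as [p [P [HP [p0 [Hpos [E1 E2]]]]]].
  pose proof (caratheodory_second p P HP p0 (fun z Hz => Rlt_le _ _ (Hpos z Hz))) as K.
  assert (E : (p 2%nat - p 1%nat * p 1%nat / RtoC 2 =
     RtoC 2 * (RtoC (alpha + 2) * gamma 2%nat - gamma 1%nat * gamma 1%nat))%C).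
  { rewrite E1, E2. rewrite !RtoC_mult, !RtoC_plus.
    field. }
  rewrite E, E1, !Cmod_mult, !Cmod_R, (Rabs_pos_eq 2), (Rabs_pos_eq (2 * (alpha + 1))) in K by lra.
  nra.
Qed.

(** The hypothesis says that (b + 1) w2 lies in the disk of centre w1^2 and radius 1
    - b^2 |w1|^2. If this disk contains 0, then |w1| <= 1 / sqrt(b^2 + 1) and only
    -|w1| matters; otherwise the distance of the disk to the origin bounds |w2| from
    below. *)
Lemma modulus_difference_bounds (b : R) (w1 w2 : C) :
  1 <= b ->
  Cmod (RtoC (b + 1) * w2 - w1 * w1)%C <= 1 - b ^ 2 * Cmod w1 ^ 2 ->
  - (1 / sqrt (b ^ 2 + 1)) <= Cmod w2 - Cmod w1 /\ Cmod w2 - Cmod w1 <= 1 / (b + 1).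
Proof.
  intros Hb H. pose proof (Cmod_ge_0 w1) as Px. pose proof (Cmod_ge_0 w2) as Py.
  set (x := Cmod w1) in *. set (y := Cmod w2) in *.
  assert (M1 : Cmod (RtoC (b + 1) * w2)%C = (b + 1) * y).
  { rewrite Cmod_mult, Cmod_R, Rabs_pos_eq by lra. reflexivity. }
  assert (M2 : Cmod (w1 * w1)%C = x ^ 2) by (rewrite Cmod_mult; fold x; ring).
  set (D := (RtoC (b + 1) * w2 - w1 * w1)%C) in *.
  assert (U : (b + 1) * y <= 1 - b ^ 2 * x ^ 2 + x ^ 2).
  { pose proof (Cmod_triangle D (w1 * w1)) as T.
    replace (D + w1 * w1)%C with (RtoC (b + 1) * w2)%C in T by (unfold D; ring). lra. }
  assert (Lw : x ^ 2 - (1 - b ^ 2 * x ^ 2) <= (b + 1) * y).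
  { pose proof (Cmod_triangle (- D) (RtoC (b + 1) * w2)) as T.
    replace (- D + RtoC (b + 1) * w2)%C with (w1 * w1)%C in T by (unfold D; ring).
    rewrite Cmod_opp in T. lra. }
  set (s := sqrt (b ^ 2 + 1)).
  assert (Ps : 0 < s) by (apply sqrt_lt_R0; nra).
  assert (Es : s * s = b ^ 2 + 1) by (apply sqrt_sqrt; nra).
  split.
  -
    (* If s x <= 1 then y >= 0 suffices; beyond, the lower estimate of y
       grows faster than x. *)
    apply Rmult_le_reg_l with s; [exact Ps|].
    replace (s * - (1 / s)) with (-1) by (field; lra).
    destruct (Rle_lt_dec (s * x) 1) as [Hs|Hs]; [nra|].
    assert (Sb : b + 1 <= 2 * s) by nra.
    apply Rmult_le_reg_l with (b + 1); [lra|].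
    assert (T : s * (s * x * (s * x) - 1) <= s * ((b + 1) * y)).
    { apply Rmult_le_compat_l; [lra|].
      replace (s * x * (s * x)) with (s * s * x ^ 2) by ring. rewrite Es. lra. }
    assert (0 <= (s * x - 1) * (s * (s * x + 1) - (b + 1))).
    { apply Rmult_le_pos; [lra|]. assert (s * 1 <= s * (s * x)) by (apply Rmult_le_compat_l; lra). lra. }
    lra.
  - apply Rmult_le_reg_l with (b + 1); [lra|].
    replace ((b + 1) * (1 / (b + 1))) with 1 by (field; lra).
    assert (0 <= (b + 1) * x) by (apply Rmult_le_pos; lra).
    assert (0 <= (b ^ 2 - 1) * x ^ 2) by (apply Rmult_le_pos; [nra|apply pow2_ge_0]). lra.
Qed.

(** * Extremal functions *)

Lemma geometric_PS (w : C) : Cmod w = 1 ->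
  exists S, has_PS (fun n => w ^ n)%C S /\
    forall z, in_disk z -> (RtoC 1 - w * z <> RtoC 0)%C /\ S z = (/ (RtoC 1 - w * z))%C.
Proof.
  intros Hw.
  assert (Sw : subexp (fun n => w ^ n)%C).
  { intros q Hq. exists 1. intros n. rewrite Cmod_pow, Hw, pow1, Rmult_1_l.
    rewrite <- (pow1 n). apply pow_incr. lra. }
  exists (power_sum (fun n => w ^ n)%C). split; [now apply has_PS_power_sum|]. intros z Hz.
  assert (N : (RtoC 1 - w * z <> RtoC 0)%C).
  { intros E. assert (E1 : (w * z = RtoC 1)%C).
    { replace (w * z)%C with (RtoC 1 - (RtoC 1 - w * z))%C by ring. rewrite E. ring. }
    apply (f_equal Cmod) in E1. rewrite Cmod_mult, Hw, Cmod_1 in E1. unfold in_disk in Hz. lra. }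
  split; [exact N|].
  set (S := power_sum (fun n => w ^ n)%C z).
  assert (E : (S = RtoC 1 + z * (w * S))%C).
  { pose proof (has_PS_power_sum _ Sw) as HS.
    refine (is_Cseries_unique _ _ _ (HS z Hz) _).
    pose proof (has_PS_plus _ _ _ _ (has_PS_poly (fun _ => RtoC 1) 0)
                  (has_PS_mult_id _ _ (has_PS_scal _ _ w HS)) z Hz) as K.
    cbv beta in K. rewrite Csum_0 in K.
    replace (RtoC 1 * z ^ 0)%C with (RtoC 1) in K by (simpl; ring).
    eapply is_Cseries_ext with (2 := K). intros [|n]; simpl; ring. }
  replace (/ (RtoC 1 - w * z))%C with ((S - z * (w * S)) / (RtoC 1 - w * z))%C; [field; exact N|].
  rewrite E at 1. field. exact N.
Qed.

Lemma Re_inv_gt_half (u : C) : Cmod u < 1 -> (RtoC 1 - u <> RtoC 0)%C -> 1 / 2 < Re (/ (RtoC 1 - u))%C.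
Proof.
  intros Hu N. pose proof (Cmod2_alt u) as M. pose proof (Cmod_ge_0 u).
  assert (Q : 0 < (1 - Re u) ^ 2 + Im u ^ 2).
  { pose proof (proj1 (Cmod_gt_0 _) N) as G. pose proof (Cmod2_alt (RtoC 1 - u)%C) as A.
    destruct u as [x y]. simpl in A |- *. nra. }
  destruct u as [x y]. simpl in *.
  apply Rmult_lt_reg_r with ((1 - x) * ((1 - x) * 1) + y * (y * 1)); [exact Q|].
  match goal with |- _ < ?a * _ => replace a with ((1 - x) / ((1 - x) * ((1 - x) * 1) + y * (y * 1))) end.
  2:{ f_equal; ring. }
  unfold Rdiv at 2. rewrite Rmult_assoc, Rinv_l by lra. nra.
Qed.

(** P(z) = (1 - z^2) / (1 - 2 c z + z^2) is the half-sum of the two functions (1 + w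
    z) / (1 - w z) where w and its conjugate are the unimodular numbers of real part
    c. Its Schwarz function is z (c - z) / (1 - c z), for which |c2| = 1 - |c1|^2.
    *)
Lemma poisson_kernel_PS (c : R) : -1 <= c <= 1 ->
  exists p P, has_PS p P /\ p 0%nat = RtoC 1 /\ (forall z, in_disk z -> 0 < Re (P z)) /\
    p 1%nat = RtoC (2 * c) /\ p 2%nat = RtoC (4 * c ^ 2 - 2).
Proof.
  intros Hc. pose (w := (c, sqrt (1 - c ^ 2)) : C).
  assert (Sq : sqrt (1 - c ^ 2) ^ 2 = 1 - c ^ 2) by (apply pow2_sqrt; nra).
  assert (M1 : Cmod w = 1).
  { change (sqrt (c ^ 2 + sqrt (1 - c ^ 2) ^ 2) = 1). rewrite Sq.
    replace (c ^ 2 + (1 - c ^ 2)) with 1 by ring. apply sqrt_1. }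
  assert (M2 : Cmod (Cconj w) = 1) by now rewrite Cmod_conj.
  destruct (geometric_PS w M1) as [S1 [H1 E1]]. destruct (geometric_PS (Cconj w) M2) as [S2 [H2 E2]].
  pose proof (has_PS_plus _ _ _ _ (has_PS_plus _ _ _ _ H1 H2) (has_PS_poly (fun _ => RtoC (-1)) 0)) as K.
  do 2 eexists. split; [exact K|]. cbv beta. split; [|split; [|split]].
  - simpl. replace (-1) with (- (1)) by ring. rewrite RtoC_opp. ring.
  - intros z Hz. destruct (E1 z Hz) as [N1 ->]. destruct (E2 z Hz) as [N2 ->].
    rewrite Csum_0. simpl Cpow. unfold in_disk in Hz.
    pose proof (Re_inv_gt_half (w * z)%C ltac:(rewrite Cmod_mult, M1; lra) N1).
    pose proof (Re_inv_gt_half (Cconj w * z)%C ltac:(rewrite Cmod_mult, M2; lra) N2).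
    rewrite !re_plus, re_scal_l. simpl (Re (RtoC 1)). lra.
  - unfold w, Cconj, RtoC, Cplus, Cmult, Cpow. simpl. f_equal; ring.
  - unfold w, Cconj, RtoC, Cplus, Cmult, Cpow. simpl. simpl in Sq. f_equal; [lra|ring].
Qed.

Lemma B1_member (alpha c : R) : 0 < alpha -> -1 <= c <= 1 ->
  exists f gamma, class_B1 alpha f /\ log_coefficients f gamma /\
    gamma 1%nat = RtoC (c / (alpha + 1)) /\
    gamma 2%nat = RtoC ((c ^ 2 * (1 + / (alpha + 1) ^ 2) - 1) / (alpha + 2)).
Proof.
  intros Ha Hc. destruct (poisson_kernel_PS c Hc) as [p [P [HP [p0 [Hpos [p1 p2]]]]]].
  destruct (B1_of_caratheodory alpha p P Ha HP p0 Hpos) as [f [gamma [HB [HL [E1 E2]]]]].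
  exists f, gamma. split; [exact HB|]. split; [exact HL|].
  assert (N1 : RtoC (2 * (alpha + 1)) <> RtoC 0) by (apply RtoC_neq_0; lra).
  assert (N2 : RtoC (2 * (alpha + 2)) <> RtoC 0) by (apply RtoC_neq_0; lra).
  assert (G1 : gamma 1%nat = RtoC (c / (alpha + 1))).
  { replace (gamma 1%nat) with (RtoC (2 * (alpha + 1)) * gamma 1%nat / RtoC (2 * (alpha + 1)))%C
      by (field; exact N1).
    rewrite <- E1, p1, <- RtoC_div by lra. f_equal. field. lra. }
  split; [exact G1|].
  replace (gamma 2%nat) with
    ((RtoC (alpha + 2) * (RtoC 2 * gamma 2%nat + RtoC (2 * alpha) * (gamma 1%nat * gamma 1%nat))
      - RtoC ((alpha + 2) * (2 * alpha)) * (gamma 1%nat * gamma 1%nat)) / RtoC (2 * (alpha + 2)))%C.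
  2:{ match goal with |- (?A / _)%C = _ =>
        replace A with (RtoC (2 * (alpha + 2)) * gamma 2%nat)%C by (rewrite !RtoC_mult; ring) end.
      field. exact N2. }
  rewrite <- E2, p2, G1, <- !RtoC_mult, <- RtoC_minus, <- RtoC_div by lra.
  f_equal. field. lra.
Qed.

Lemma upper_bound_attained (alpha : R) : 0 < alpha ->
  exists f gamma, class_B1 alpha f /\ log_coefficients f gamma /\
    Cmod (gamma 2%nat) - Cmod (gamma 1%nat) = 1 / (alpha + 2).
Proof.
  intros Ha. destruct (B1_member alpha 0 Ha ltac:(lra)) as [f [gamma [HB [HL [E1 E2]]]]].
  exists f, gamma. split; [exact HB|]. split; [exact HL|].
  rewrite E1, E2, !Cmod_R.
  replace (0 / (alpha + 1)) with 0 by (field; lra).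
  replace ((0 ^ 2 * (1 + / (alpha + 1) ^ 2) - 1) / (alpha + 2)) with (- (1 / (alpha + 2))) by (field; lra).
  rewrite Rabs_R0, Rabs_Ropp, Rabs_pos_eq; [ring|].
  left. apply Rdiv_lt_0_compat; lra.
Qed.

Lemma lower_bound_attained (alpha : R) : 0 < alpha ->
  exists f gamma, class_B1 alpha f /\ log_coefficients f gamma /\
    Cmod (gamma 2%nat) - Cmod (gamma 1%nat) = - (1 / sqrt ((alpha + 1) ^ 2 + 1)).
Proof.
  intros Ha. set (s := sqrt ((alpha + 1) ^ 2 + 1)).
  assert (Ps : 0 < s) by (apply sqrt_lt_R0; nra).
  assert (Es : s ^ 2 = (alpha + 1) ^ 2 + 1) by (apply pow2_sqrt; nra).
  assert (Bs : alpha + 1 <= s) by nra.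
  assert (Hc : 0 <= (alpha + 1) / s <= 1).
  { split; [left; apply Rdiv_lt_0_compat; lra|].
    apply Rmult_le_reg_r with s; [exact Ps|]. unfold Rdiv. rewrite Rmult_assoc, Rinv_l; lra. }
  (* This parameter makes [gamma 2] vanish. *)
  destruct (B1_member alpha ((alpha + 1) / s) Ha ltac:(lra)) as [f [gamma [HB [HL [E1 E2]]]]].
  exists f, gamma. split; [exact HB|]. split; [exact HL|].
  rewrite E1, E2, !Cmod_R.
  replace ((alpha + 1) / s / (alpha + 1)) with (1 / s) by (field; lra).
  replace ((((alpha + 1) / s) ^ 2 * (1 + / (alpha + 1) ^ 2) - 1) / (alpha + 2)) with 0.
  2:{ replace (((alpha + 1) / s) ^ 2 * (1 + / (alpha + 1) ^ 2)) with (((alpha + 1) ^ 2 + 1) / s ^ 2)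
        by (field; lra).
      rewrite <- Es. field. lra. }
  rewrite Rabs_R0, Rabs_pos_eq; [ring|]. left. apply Rdiv_lt_0_compat; lra.
Qed.

(** * The quartic equation *)

Lemma alpha1_bounds : 0.2247 <= alpha1 < 0.2248.
Proof.
  assert (S : sqrt 6 * sqrt 6 = 6) by (apply sqrt_sqrt; lra).
  assert (P : 0 <= sqrt 6) by apply sqrt_pos. unfold alpha1. split; nra.
Qed.

Lemma alpha2_bounds : 0.4142 <= alpha2 < 0.4143.
Proof.
  assert (S : sqrt 2 * sqrt 2 = 2) by (apply sqrt_sqrt; lra).
  assert (P : 0 <= sqrt 2) by apply sqrt_pos. unfold alpha2. split; nra.
Qed.

(** The quartic factors as (2 x^2 + 4 x - 1) (x^2 + 2 x - 1), and each factor has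
    exactly one positive root. *)
Lemma quartic_positive_roots (x : R) :
  (0 < x /\ 2 * x ^ 4 + 8 * x ^ 3 + 5 * x ^ 2 - 6 * x + 1 = 0) <-> (x = alpha1 \/ x = alpha2).
Proof.
  pose proof alpha1_bounds as B1. pose proof alpha2_bounds as B2.
  assert (R1 : 2 * alpha1 ^ 2 + 4 * alpha1 - 1 = 0).
  { assert (S : sqrt 6 * sqrt 6 = 6) by (apply sqrt_sqrt; lra). unfold alpha1. nra. }
  assert (R2 : alpha2 ^ 2 + 2 * alpha2 - 1 = 0).
  { assert (S : sqrt 2 * sqrt 2 = 2) by (apply sqrt_sqrt; lra). unfold alpha2. nra. }
  replace (2 * x ^ 4 + 8 * x ^ 3 + 5 * x ^ 2 - 6 * x + 1)
    with ((2 * x ^ 2 + 4 * x - 1) * (x ^ 2 + 2 * x - 1)) by ring.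
  split.
  - intros [Px H]. apply Rmult_integral in H. destruct H as [H|H].
    + left. assert (K : (x - alpha1) * (x + alpha1 + 2) = 0) by lra.
      apply Rmult_integral in K. lra.
    + right. assert (K : (x - alpha2) * (x + alpha2 + 2) = 0) by lra.
      apply Rmult_integral in K. lra.
  - intros [->| ->]; (split; [lra|]).
    + rewrite R1. ring.
    + rewrite R2. ring.
Qed.

Theorem theorem1 :
  (forall (alpha : R) (f : C -> C) (gamma : nat -> C),
     0 < alpha -> class_B1 alpha f -> log_coefficients f gamma ->
     - (1 / sqrt ((alpha + 1) ^ 2 + 1)) <= Cmod (gamma 2%nat) - Cmod (gamma 1%nat)
     /\ Cmod (gamma 2%nat) - Cmod (gamma 1%nat) <= 1 / (alpha + 2))
  /\
  (forall alpha : R, 0 < alpha ->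
     exists (f : C -> C) (gamma : nat -> C),
       class_B1 alpha f /\ log_coefficients f gamma /\
       Cmod (gamma 2%nat) - Cmod (gamma 1%nat) = 1 / (alpha + 2))
  /\
  (forall alpha : R, alpha1 <= alpha <= alpha2 ->
     exists (f : C -> C) (gamma : nat -> C),
       class_B1 alpha f /\ log_coefficients f gamma /\
       Cmod (gamma 2%nat) - Cmod (gamma 1%nat) = - (1 / sqrt ((alpha + 1) ^ 2 + 1)))
  /\
  (forall x : R,
     (0 < x /\ 2 * x ^ 4 + 8 * x ^ 3 + 5 * x ^ 2 - 6 * x + 1 = 0)
     <-> (x = alpha1 \/ x = alpha2))
  /\
  0.2247 <= alpha1 < 0.2248 /\ 0.4142 <= alpha2 < 0.4143.
Proof.
  split; [|split; [|split; [|split; [|split]]]].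
  - intros alpha f gamma Ha Hf Hg.
    replace (alpha + 2) with (alpha + 1 + 1) by ring.
    apply (modulus_difference_bounds (alpha + 1)); [lra|].
    replace (alpha + 1 + 1) with (alpha + 2) by ring.
    exact (B1_coefficient_body alpha f gamma Ha Hf Hg).
  - exact upper_bound_attained.
  - intros alpha Hal. apply lower_bound_attained. pose proof alpha1_bounds. lra.
  - exact quartic_positive_roots.
  - exact alpha1_bounds.
  - exact alpha2_bounds.
Qed.
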